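(* Let $\beta$ be an ordinal of countable cofinality. Then $\mathscr{SZ}_{\omega^\beta}$ does not have the factorization property; that is, there exist Banach spaces $E,F$ and an operator $T:E\to F$ with $\mathrm{Sz}(T)\leqslant\omega^{\omega^\beta}$ such that $T$ does not factor (with bounded linear factors) through any Banach space $G$ with $\mathrm{Sz}(G)\leqslant\omega^{\omega^\beta}$.
   Context: Banach spaces are over $\mathbb K\in\{\mathbb R,\mathbb C\}$; an operator is a bounded linear map between Banach spaces; $B_E$ is the closed unit ball of $E$; $T^*$ is the adjoint of $T$. An ordinal is of countable cofinality if its cofinality is at most $\omega$ (this includes $0$ and all successor ordinals). Szlenk index. Let $E$ be a Banach space, $K\subseteq E^*$ a $w^*$-compact set and $\varepsilon>0$. Put $s_\varepsilon(K)=\{x\in K : \operatorname{diam}(K\cap V)>\varepsilon \text{ for every } w^*\text{-open } V\ni x\}$ (norm diameter), $s^0_\varepsilon(K)=K$, $s^{\alpha+1}_\varepsilon(K)=s_\varepsilon(s^\alpha_\varepsilon(K))$, and $s^\alpha_\varepsilon(K)=\bigcap_{\beta<\alpha}s^\beta_\varepsilon(K)$ for limit ordinals $\alpha$. $\mathrm{Sz}_\varepsilon(K)$ is the class of all ordinals $\alpha$ with $s^\alpha_\varepsilon(K)\neq\emptyset$; that is, the least ordinal $\alpha$ with $s^\alpha_\varepsilon(K)=\emptyset$ if one exists, and otherwise the class of all ordinals, written $\infty$. $\mathrm{Sz}(K)=\bigcup_{\varepsilon>0}\mathrm{Sz}_\varepsilon(K)=\sup_{\varepsilon>0}\mathrm{Sz}_\varepsilon(K)$.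 For a Banach space $E$, $\mathrm{Sz}(E)=\mathrm{Sz}(B_{E^*})$; for an operator $T:E\to F$, $\mathrm{Sz}(T)=\mathrm{Sz}(T^*B_{F^*})$. $\mathscr{SZ}_\alpha$ is the class of all operators $T$ with $\mathrm{Sz}(T)\leqslant\omega^\alpha$. An operator ideal $\mathscr I$ has the factorization property if every element of $\mathscr I$ factors (with bounded linear factors) through a Banach space whose identity operator belongs to $\mathscr I$. *)

(* Defs.v *)
From HB Require Import structures.
From mathcomp Require Import all_boot all_order all_algebra.
From mathcomp Require Import all_classical all_reals ereal topology normedtype.
From mathcomp.real_closed Require Import complex.

Set Implicit Arguments.
Unset Strict Implicit.
Unset Printing Implicit Defensive.

Import Order.TTheory GRing.Theory Num.Theory.
Import numFieldNormedType.Exports.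

Local Open Scope classical_set_scope.
Local Open Scope ring_scope.

(** Ordinals are represented by well-founded trees, where [OSup i0 f] stands
    for the supremum of a nonempty small family [f].  An ordinal has many
    representatives, so equality of ordinals is [oeq], not [=].  The lemmas
    [ole_refl] to [olt_wf] say that trees modulo [oeq] are well-ordered with
    zero, successors and suprema, and [ordinal_of_wf] that every well-founded
    transitive relation on a small type is ranked, without gaps, by them.  *)

Inductive Ord : Type :=
| OZero
| OSucc (a : Ord)
| OSup (I : Type) (i0 : inhabited I) (f : I -> Ord).

Fixpoint ole (a : Ord) : Ord -> Prop :=
  match a with
  | OZero => fun _ => True
  | OSucc a' =>
      fix olt_a' (b : Ord) : Prop :=
        match b with
        | OZero => False
        | OSucc b' => ole a' b'
        | OSup J _ g => exists i : J, olt_a' (g i)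
        end
  | OSup J _ f => fun b => forall i : J, ole (f i) b
  end.

Definition olt (a b : Ord) : Prop := ole (OSucc a) b.

Definition oeq (a b : Ord) : Prop := ole a b /\ ole b a.

Definition olimit (a : Ord) : Prop :=
  olt OZero a /\ forall b, olt b a -> olt (OSucc b) a.

Fixpoint oadd (a b : Ord) : Ord :=
  match b with
  | OZero => a
  | OSucc b' => OSucc (oadd a b')
  | OSup J i0 g => OSup i0 (fun i => oadd a (g i))
  end.

Fixpoint omul (a b : Ord) : Ord :=
  match b with
  | OZero => OZero
  | OSucc b' => oadd (omul a b') a
  | OSup J i0 g => OSup i0 (fun i => omul a (g i))
  end.

Definition onat (n : nat) : Ord := iter n OSucc OZero.

Definition oomega : Ord := OSup (inhabits 0%N) onat.

Fixpoint oomega_pow (a : Ord) : Ord :=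
  match a with
  | OZero => onat 1
  | OSucc a' => omul (oomega_pow a') oomega
  | OSup J i0 g => OSup i0 (fun i => oomega_pow (g i))
  end.

(** A map from the ordinals below [k] to the ordinals below [b] with cofinal
    range; compatibility with [oeq] makes it a map of ordinals.  *)
Definition cofinal_map (k b : Ord) (f : Ord -> Ord) : Prop :=
  [/\ forall x y, olt x k -> oeq x y -> oeq (f x) (f y),
      forall x, olt x k -> olt (f x) b
    & forall a, olt a b -> exists2 x, olt x k & ole a (f x)].

Definition is_cofinality (b k : Ord) : Prop :=
  (exists f, cofinal_map k b f) /\
  forall k', (exists f, cofinal_map k' b f) -> ole k k'.

Definition countable_cofinality (b : Ord) : Prop :=
  exists2 k, is_cofinality b k & ole k oomega.

Section OrdinalFacts.

Lemma ole_sup_r a I (i0 : inhabited I) (f : I -> Ord) i :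
  ole a (f i) -> ole a (OSup i0 f).
Proof.
elim: a => [|a _|J j0 g IH] //=; first by exists i.
by move=> h j; apply: IH.
Qed.

Lemma ole_refl a : ole a a.
Proof. by elim: a => [|a|I i0 f IH] //= i; exact: ole_sup_r. Qed.

Lemma olt_ole a b : olt a b -> ole a b.
Proof.
elim: a b => [|a IHa|I i0 f IHf] b //.
- elim: b => [|b _|J j0 g IHg] //; first exact: IHa.
  by move=> [j /IHg h]; exists j.
- elim: b => [|b IHb|J j0 g IHg] //= h i.
  + exact/IHf/h.
  + by case: h => j h; apply: (@ole_sup_r _ _ _ _ j); exact: IHg h i.
Qed.

Lemma ole_trans b a c : ole a b -> ole b c -> ole a c.
Proof.
elim: a b c => [|a IHa|I i0 f IHf] b c //.
- elim: b c => [|b _|J j0 g IHg] c //.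
  + elim: c => [|c _|L l0 h IHh] //; first exact: IHa.
    by move=> ab [l bl]; exists l; exact: IHh ab bl.
  + by move=> [j aj] gc; exact: IHg aj (gc j).
- by move=> fb bc i; exact: IHf (fb i) bc.
Qed.

Lemma ole_olt_trans b a c : ole a b -> olt b c -> olt a c.
Proof. by move=> ab; apply: ole_trans. Qed.

Lemma olt_ole_trans b a c : olt a b -> ole b c -> olt a c.
Proof. exact: ole_trans. Qed.

Lemma ole_total a b : ole a b \/ olt b a.
Proof.
suff: (ole a b \/ olt b a) /\ (ole b a \/ olt a b) by case.
elim: a b => [|a IHa|I i0 f IHf] b.
- split; first by left.
  elim: b => [|b _|J j0 g IHg]; [by left | by right |].
  have [[j gj]|h] := pselect (exists j, olt OZero (g j)).
    by right; exists j.
  by left=> j; case: (IHg j) => // gj; case: h; exists j.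
- split; first by case: (IHa b) => _ [ba|ab]; [right | left].
  elim: b => [|b _|J j0 g IHg]; [by left | |].
    by case: (IHa b) => _ [ba|ab]; [left | right].
  have [[j gj]|h] := pselect (exists j, olt (OSucc a) (g j)).
    by right; exists j.
  by left=> j; case: (IHg j) => // gj; case: h; exists j.
- split.
    have [[j fj]|h] := pselect (exists j, olt b (f j)); first by right; exists j.
    by left=> j; case: (IHf j b) => [[//|fj] _]; case: h; exists j.
  elim: b => [|b _|J j0 g IHg]; [by left | |].
    have [[j fj]|h] := pselect (exists j, olt b (f j)); first by left; exists j.
    by right=> j; case: (IHf j b) => [[//|fj] _]; case: h; exists j.
  have [[j gj]|h] := pselect (exists j, olt (OSup i0 f) (g j)).
    by right; exists j.
  by left=> j; case: (IHg j) => // gj; case: h; exists j.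
Qed.

Lemma olt_wf : well_founded olt.
Proof.
move=> a; suff: forall b, ole b a -> Acc olt b by apply; exact: ole_refl.
elim: a => [|a IHa|I i0 f IHf] b ba; constructor=> c cb;
  have := olt_ole_trans cb ba.
- by [].
- exact: IHa.
- by case=> i /olt_ole; exact: IHf.
Qed.

Lemma olt_irrefl a : ~ olt a a.
Proof. by elim: (olt_wf a) => b _ IH bb; exact: (IH b). Qed.

Lemma olt_succ a : olt a (OSucc a).
Proof. exact: ole_refl. Qed.

Lemma ole_sup I (i0 : inhabited I) (f : I -> Ord) b :
  ole (OSup i0 f) b <-> forall i, ole (f i) b.
Proof. by []. Qed.

Lemma ordinal_of_wf (W : Type) (lt : W -> W -> Prop) :
  well_founded lt -> (forall u v w, lt u v -> lt v w -> lt u w) ->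
  exists r : W -> Ord,
    (forall v w, lt v w -> olt (r v) (r w)) /\
    (forall w a, olt a (r w) -> exists2 v, lt v w & oeq a (r v)).
Proof.
move=> wf tr.
pose F w (rec : forall v, lt v w -> Ord) :=
  OSup (inhabits None) (fun o : option {v | lt v w} =>
    if o is Some u then OSucc (rec (sval u) (svalP u)) else OZero).
pose r := Fix wf _ F.
have rE w : r w = F w (fun v _ => r v).
  rewrite /r Fix_eq // => x g h gh; congr F.
  by apply: functional_extensionality_dep => y;
     apply: functional_extensionality_dep => p.
have rlt v w : lt v w -> olt (r v) (r w).
  move=> vw; rewrite (rE w); exists (Some (exist _ v vw)); exact: olt_succ.
exists r; split=> // w; elim: (wf w) => {}w _ IH a aw.
move: (aw); rewrite (rE w) => -[[[v vw]|//] /= av].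
have [va|av'] := ole_total (r v) a; first by exists v.
by have [u uv au] := IH v vw a av'; exists u => //; exact: tr uv vw.
Qed.

End OrdinalFacts.

Variant scalar_kind := RealScalars | ComplexScalars.

Definition scalars (R : realType) (k : scalar_kind) : numFieldType :=
  match k with
  | RealScalars => R
  | ComplexScalars => R[i]
  end.

(** Norms of [normedModType K] are valued in [K] itself; [modulus] is the
    absolute value on [K] as an element of [R].  *)
Definition modulus (R : realType) (k : scalar_kind) : scalars R k -> R :=
  match k return scalars R k -> R with
  | RealScalars => fun z => `|z|
  | ComplexScalars => fun z => complex.Re `|z|
  end.

Section Operators.
Context {K : numFieldType}.

Record operator (E F : normedModType K) := Operator {
  op_fun :> {linear E -> F};
  op_bounded : bounded_near op_fun (nbhs (0 : E))
}.

HB.instance Definition _ (E F : normedModType K) := gen_eqMixin (operator E F).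
HB.instance Definition _ (E F : normedModType K) :=
  gen_choiceMixin (operator E F).

Program Definition op_id (E : normedModType K) : operator E E :=
  @Operator E E (idfun : {linear E -> E}) _.
Next Obligation.
by move=> E; apply/linear_bounded_continuous => x; exact: cvg_id.
Qed.

Program Definition op_comp (E F G : normedModType K)
    (S : operator F G) (T : operator E F) : operator E G :=
  @Operator E G (op_fun S \o op_fun T : {linear E -> G}) _.
Next Obligation.
move=> E F G S T; apply/linear_bounded_continuous => x.
apply: continuous_comp.
- exact: (bounded_linear_continuous (op_bounded T)).
- exact: (bounded_linear_continuous (op_bounded S)).
Qed.

Definition dual_space (E : normedModType K) := operator E K^o.

Definition adjoint (E F : normedModType K) (T : operator E F) :
    dual_space F -> dual_space E :=
  fun g => op_comp g T.

Definition weak_star (E : normedModType K) :=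
  initial_topology (fun f : dual_space E => (f : E -> K^o) : {ptws E -> K^o}).

End Operators.

Section Szlenk.
Context {R : realType} {k : scalar_kind}.
Notation K := (scalars R k).

Definition sup_norm_ball (E : normedModType K) (f : E -> K) : \bar R :=
  ereal_sup [set (modulus (f x))%:E | x in [set x : E | `|x| <= 1]].

Definition dual_norm (E : normedModType K) (f : dual_space E) : \bar R :=
  sup_norm_ball (f : E -> K^o).

Definition dual_dist (E : normedModType K) (f g : dual_space E) : \bar R :=
  sup_norm_ball (fun x => f x - g x).

Definition dual_ball (E : normedModType K) : set (dual_space E) :=
  [set f | (dual_norm f <= 1)%E].
Arguments dual_ball : clear implicits.

Definition diam (E : normedModType K) (A : set (dual_space E)) : \bar R :=
  ereal_sup [set dual_dist fg.1 fg.2 | fg in A `*` A].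

Definition szlenk_derivative (E : normedModType K) (eps : R)
    (A : set (dual_space E)) : set (dual_space E) :=
  [set f | A f /\ forall V : set (weak_star E),
     open V -> V f -> (eps%:E < diam (A `&` V))%E].

(** At [OSup i0 f] this is the intersection over the family [f]; see
    [szlenk_iter_limit] for the usual clause at limit ordinals.  *)
Fixpoint szlenk_iter (E : normedModType K) (eps : R) (A : set (dual_space E))
    (a : Ord) : set (dual_space E) :=
  match a with
  | OZero => A
  | OSucc a' => szlenk_derivative eps (szlenk_iter eps A a')
  | OSup J _ f => [set g | forall i : J, szlenk_iter eps A (f i) g]
  end.

(** Szlenk indices are initial segments of the class of all ordinals, that is
    ordinals or the whole class.  *)
Definition Sz_eps (E : normedModType K) (eps : R) (A : set (dual_space E)) :
    Ord -> Prop :=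
  fun a => szlenk_iter eps A a !=set0.

Definition Sz (E : normedModType K) (A : set (dual_space E)) : Ord -> Prop :=
  fun a => exists2 eps : R, 0 < eps & Sz_eps eps A a.

Definition Sz_space (E : completeNormedModType K) : Ord -> Prop :=
  Sz (dual_ball E).

Definition Sz_operator (E F : completeNormedModType K) (T : operator E F) :
    Ord -> Prop :=
  Sz (adjoint T @` dual_ball F).

Definition index_le (S : Ord -> Prop) (b : Ord) : Prop :=
  forall a, S a -> olt a b.

Definition operator_class :=
  forall E F : completeNormedModType K, operator E F -> Prop.

Definition SZ (a : Ord) : operator_class :=
  fun E F T => index_le (Sz_operator T) (oomega_pow a).

Definition factors_through (E F : completeNormedModType K) (T : operator E F)
    (G : completeNormedModType K) : Prop :=
  exists (A : operator E G) (B : operator G F), forall x, T x = B (A x).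

Definition factorization_property (I : operator_class) : Prop :=
  forall (E F : completeNormedModType K) (T : operator E F), I E F T ->
  exists2 G : completeNormedModType K, I G G (op_id G) & factors_through T G.

Section SzlenkFacts.
Variables (E : normedModType K) (eps : R) (A : set (dual_space E)).

Lemma szlenk_derivative_mono (B C : set (dual_space E)) :
  B `<=` C -> szlenk_derivative eps B `<=` szlenk_derivative eps C.
Proof.
move=> BC f [Bf h]; split=> [|V oV Vf]; first exact: BC.
apply: (lt_le_trans (h V oV Vf)); apply: ereal_sup_le => _ [fg [[p1 p2] [q1 q2]] <-].
by exists fg => //; split; split=> //; exact: BC.
Qed.

Lemma szlenk_iter_anti a b :
  ole a b -> szlenk_iter eps A b `<=` szlenk_iter eps A a.
Proof.
elim: a b => [|a IHa|I i0 f IHf] b.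
- move=> _; elim: b => [|b IHb|J [j0] g IHg] //= x; first by case=> /IHb.
  by move/(_ j0)/IHg.
- elim: b => [|b _|J j0 g IHg] //=.
    by move=> ab; apply: szlenk_derivative_mono; exact: IHa.
  by move=> [j aj] x /(_ j); exact: IHg aj x.
- by move=> fb x bx i; exact: IHf (fb i) x bx.
Qed.

Lemma szlenk_iter_limit a : olimit a ->
  szlenk_iter eps A a = [set g | forall b, olt b a -> szlenk_iter eps A b g].
Proof.
move=> [a0 aS]; rewrite eqEsubset; split=> [g ag b ba|g h].
  exact: szlenk_iter_anti (olt_ole ba) _ ag.
suff H c : ole c a -> szlenk_iter eps A c g by exact/H/ole_refl.
elim: c => [_|c _ ca|I i0 f IH fa]; first exact: h.
  exact/h/aS.
by move=> i; exact/IH/fa.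
Qed.

End SzlenkFacts.

End Szlenk.

(* Main.v *)
Require Import Defs.
From HB Require Import structures.
From mathcomp Require Import all_boot all_order all_algebra.
From mathcomp Require Import all_classical all_reals ereal topology normedtype.
From mathcomp Require Import ring lra.
From mathcomp.real_closed Require Import complex.

(** Let [lam = w^(w^b)], which is closed under products and, by the hypothesis
    on [b], of countable cofinality.  If [Sz G <= lam] then, by weak-star
    compactness, the [1/2]-index of [G] is at most some [a < lam], and by
    submultiplicativity its [2^-n]-index is at most [a^n].  So it suffices to
    find an operator [T] with [Sz T <= lam] whose [2^-n]-indices outgrow every
    sequence [a^n].

    Take a forest whose [i]-th tree has rank [theta_i < lam], every node having
    infinitely many children of each rank below its own.  Let [T] be the diagonal
    operator with entries [2^-i] on the [i]-th tree, going from [l_1] of the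
    forest to the completion [F] of the finitely supported functions under the
    supremum over chains of the [l_1]-norms.  For a node [t] let [h_t] be the
    functional summing over the ancestors of [t]; it is the weak-star limit of
    [h_u] over children [u] of [t] of any fixed rank, so the [2^-i]-index of [T]
    and of any space through which [T] factors is, up to a constant in front of
    [2^-i], at least [theta_i].

    For the upper bound, the coordinates of [T^* phi] with [phi] in the unit
    ball have [l_1]-norm at most [1] on every antichain, hence an antichain of
    nodes at which they exceed [e / 2] has fewer than [M] elements.  The ranks of
    these nodes form an [M]-tuple of ordinals below some [z < lam]; near a
    functional in the derived set any new large coordinate allows one entry to be
    decreased, so the [e]-index is at most the lexicographic rank of such tuples,
    about [z^M < lam].  *)

Set Implicit Arguments.
Unset Strict Implicit.
Unset Printing Implicit Defensive.

Import Order.TTheory GRing.Theory Num.Theory.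
Import numFieldNormedType.Exports.

(** * Ordinal arithmetic *)

Section OrdinalArithmetic.
Implicit Types a b c d x y z : Ord.

Lemma olt_trans b a c : olt a b -> olt b c -> olt a c.
Proof. by move=> ab /olt_ole; exact: olt_ole_trans. Qed.

Lemma ole_addr a b : ole a (oadd a b).
Proof.
elim: b => [|b IH|J j0 g IH] /=; first exact: ole_refl.
  exact: ole_trans IH (olt_ole (olt_succ _)).
by case: (j0) => j; exact: (ole_sup_r _ (i:=j)).
Qed.

Lemma add0o b : oadd OZero b = b.
Proof.
by elim: b => [|b /= ->|J j0 g IH] //=; congr OSup; apply: funext.
Qed.

Lemma oaddA a b c : oadd a (oadd b c) = oadd (oadd a b) c.
Proof.
by elim: c => [|c /= ->|J j0 g IH] //=; congr OSup; apply: funext.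
Qed.

Lemma omulDr a b c : omul a (oadd b c) = oadd (omul a b) (omul a c).
Proof.
elim: c => [|c /= ->|J j0 g IH] //=; first by rewrite oaddA.
by congr OSup; apply: funext.
Qed.

Lemma omulA a b c : omul a (omul b c) = omul (omul a b) c.
Proof.
elim: c => [|c /= <-|J j0 g IH] //=; first by rewrite omulDr.
by congr OSup; apply: funext.
Qed.

Lemma omul1 a : omul a (onat 1) = a.
Proof. exact: add0o. Qed.

Lemma oomega_powD a b :
  oomega_pow (oadd a b) = omul (oomega_pow a) (oomega_pow b).
Proof.
elim: b => [|b IH|J j0 g IH]; first by rewrite omul1.
- transitivity (omul (omul (oomega_pow a) (oomega_pow b)) oomega).
    exact: (congr1 (omul^~ oomega) IH).
  by rewrite -omulA.
- by congr OSup; apply: funext.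
Qed.

Lemma oadd_le2 a a' b b' : ole a a' -> ole b b' -> ole (oadd a b) (oadd a' b').
Proof.
move=> aa'; elim: b b' => [|b IH|J j0 g IH] b' //.
- by move=> _; exact: ole_trans aa' (ole_addr _ _).
- elim: b' => [//|b' _|J j0 g IHg]; first exact: IH.
  by move=> [j bj]; exists j; exact: IHg.
- by move=> gb j; exact: IH.
Qed.

Lemma ole_addl a b : ole b (oadd a b).
Proof. by rewrite -[X in ole X _]add0o; apply: oadd_le2 => //; exact: ole_refl. Qed.

Lemma oadd_lt a b b' : olt b b' -> olt (oadd a b) (oadd a b').
Proof. by move=> bb'; exact: (oadd_le2 (ole_refl a) bb'). Qed.

Lemma omul_le2 a a' b b' : ole a a' -> ole b b' -> ole (omul a b) (omul a' b').
Proof.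
move=> aa'; elim: b b' => [|b IH|J j0 g IH] b' //.
- elim: b' => [//|b' _|J j0 g IHg].
    by move=> bb'; apply: oadd_le2 => //; exact: IH.
  by move=> [j bj]; apply: (ole_sup_r _ (i:=j)); exact: IHg.
- by move=> gb j; exact: IH.
Qed.

Lemma omul_lex c a a' b : olt a a' -> olt b c ->
  olt (oadd (omul c a) b) (omul c a').
Proof.
move=> aa' bc; apply: (olt_ole_trans (oadd_lt _ bc)).
exact: (omul_le2 (ole_refl c) aa').
Qed.

Lemma omul_lt c a a' : olt OZero c -> olt a a' -> olt (omul c a) (omul c a').
Proof. by move=> c0 aa'; exact: (omul_lex aa' c0). Qed.

Lemma mul0o b : ole (omul OZero b) OZero.
Proof. by elim: b. Qed.

Lemma onat_lt m n : (m < n)%N -> olt (onat m) (onat n).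
Proof.
elim: n m => // n IH [|m]; first by [].
by rewrite ltnS => /IH; exact.
Qed.

Lemma onat_le m n : (m <= n)%N -> ole (onat m) (onat n).
Proof. exact: (@onat_lt m n.+1). Qed.

Lemma oadd_onat m n : oadd (onat m) (onat n) = onat (m + n).
Proof. by elim: n => [|n IH]; rewrite ?addn0// addnS /= -IH. Qed.

Lemma omul_onat m n : omul (onat m) (onat n) = onat (m * n).
Proof.
elim: n => [|n IH]; first by rewrite muln0.
by rewrite mulnS addnC -oadd_onat -IH.
Qed.

Lemma onat_omega n : olt (onat n) oomega.
Proof. by exists n.+1; exact: olt_succ. Qed.

Lemma oomega_pow_gt0 a : olt OZero (oomega_pow a).
Proof.
elim: a => [|a IH|J [j] g IH] //; last by exists j; exact: IH.
by apply: olt_ole_trans IH _; apply: (ole_sup_r _ (i:=1%N)); rewrite /= add0o; exact: ole_refl.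
Qed.

Lemma oomega_pow_le a b : ole a b -> ole (oomega_pow a) (oomega_pow b).
Proof.
elim: a b => [|a IH|J j0 g IH] b; first by move=> _; exact: oomega_pow_gt0.
- elim: b => [//|b _|J j0 g IHg].
    by move=> ab; apply: omul_le2; [exact: IH | exact: ole_refl].
  by move=> [j bj]; apply: (ole_sup_r _ (i:=j)); exact: IHg.
- by move=> gb j; exact: IH.
Qed.

Lemma oomega_pow_lt a b : olt a b -> olt (oomega_pow a) (oomega_pow b).
Proof.
move=> /oomega_pow_le; apply: olt_ole_trans.
by have := omul_lt (oomega_pow_gt0 a) (onat_omega 1); rewrite omul1.
Qed.

(** This stands in for the leading term of the Cantor normal form; the closure properties below are
    read off from it. The first alternative covers [d] zero, where no [c] lies below [d]. *)
Lemma olt_oomega_pow x d : olt x (oomega_pow d) ->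
  ole x OZero \/
  exists c n, olt c d /\ ole x (omul (oomega_pow c) (onat n)).
Proof.
elim: d => [h|d IH|J j0 g IH]; first by left.
- move=> [n xn]; right; exists d, n; split; first exact: olt_succ.
  exact: olt_ole.
- move=> [j /IH[x0|[c [n [cd xn]]]]]; first by left.
  by right; exists c, n; split => //; exists j.
Qed.

Lemma omul_onat_lt_pow c n : olt (omul (oomega_pow c) (onat n)) (oomega_pow (OSucc c)).
Proof. by apply: omul_lt; [exact: oomega_pow_gt0 | exact: onat_omega]. Qed.

Lemma omax_ex (P : Ord -> Prop) x y : P x -> P y ->
  exists z, [/\ P z, ole x z & ole y z].
Proof.
move=> Px Py; have [xy|/olt_ole yx] := ole_total x y.
  by exists y; split=> //; exact: ole_refl.
by exists x; split=> //; exact: ole_refl.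
Qed.

(** Both summands are bounded by multiples of one power [w^e] with [e < b]; so is the sum, which is
    therefore below [w^(e+1)], and this is at most [w^b]. *)
Lemma oomega_pow_add b x y : olt OZero b ->
  olt x (oomega_pow b) -> olt y (oomega_pow b) -> olt (oadd x y) (oomega_pow b).
Proof.
move=> b0.
have key z : olt z (oomega_pow b) ->
    exists c n, olt c b /\ ole z (omul (oomega_pow c) (onat n)).
  by move=> /olt_oomega_pow[z0|//]; exists OZero, 0; split.
move=> /key[c [n [cb xn]]] /key[c' [n' [c'b yn]]].
have [e [eb ce c'e]] := @omax_ex (olt^~ b) _ _ cb c'b.
apply: (@ole_olt_trans (omul (oomega_pow e) (onat (n + n')))).
  rewrite -oadd_onat omulDr; apply: oadd_le2.
    by apply: ole_trans xn _; apply: omul_le2 (ole_refl _); exact: oomega_pow_le.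
  by apply: ole_trans yn _; apply: omul_le2 (ole_refl _); exact: oomega_pow_le.
exact: olt_ole_trans (omul_onat_lt_pow _ _) (oomega_pow_le eb).
Qed.

End OrdinalArithmetic.

(** * Closure properties of the ordinals below [w^(w^b)] *)

Section MultiplicativelyIndecomposable.
Variable b : Ord.
Local Notation lam := (oomega_pow (oomega_pow b)).
Implicit Types x y : Ord.

Lemma onat_lt_tower n : olt (onat n) lam.
Proof.
apply: (@olt_ole_trans (oomega_pow (onat 1))); last first.
  by apply: oomega_pow_le; exact: oomega_pow_gt0.
apply: olt_ole_trans (onat_omega n) _; rewrite -[oomega]add0o => m.
by apply: (ole_sup_r _ (i:=m)); elim: m.
Qed.

(** The factors lie below [w^(c+1)] and [w^(c'+1)], whose product has the exponent [(c+1) + (c'+1)];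
    this is below [w^b] because [w^b] is additively indecomposable. *)
Lemma tower_mul x y : olt x lam -> olt y lam -> olt (omul x y) lam.
Proof.
move=> /olt_oomega_pow[x0 _|[c [n [cb xn]]]].
  apply: (@ole_olt_trans OZero); last exact: oomega_pow_gt0.
  exact: ole_trans (omul_le2 x0 (ole_refl y)) (mul0o y).
move=> /olt_oomega_pow[y0|[c' [n' [c'b yn]]]].
  apply: (@ole_olt_trans OZero); last exact: oomega_pow_gt0.
  exact: omul_le2 (ole_refl x) y0.
apply: (ole_olt_trans (omul_le2 xn yn)).
(* For [b] zero the exponent [w^b] is [1], so both powers are at most [1] and the product is
   finite. *)
have [b0|b0] := ole_total b OZero.
  have c0 z : olt z (oomega_pow b) -> ole (oomega_pow z) (onat 1).
    move=> /olt_ole_trans /(_ (oomega_pow_le b0)) z0.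
    exact: (@oomega_pow_le z OZero).
  apply: (ole_olt_trans (omul_le2 (omul_le2 (c0 _ cb) (ole_refl _))
    (omul_le2 (c0 _ c'b) (ole_refl _)))).
  by rewrite !omul_onat; exact: onat_lt_tower.
apply: (ole_olt_trans (omul_le2 (olt_ole (omul_onat_lt_pow c n))
  (olt_ole (omul_onat_lt_pow c' n')))).
rewrite -oomega_powD; apply: oomega_pow_lt.
have S1 z : olt z (oomega_pow b) -> olt (OSucc z) (oomega_pow b).
  move=> zb; apply: (@oomega_pow_add b z (onat 1)) => //.
  apply: (@olt_ole_trans (oomega_pow (onat 1))); last exact: oomega_pow_le.
  exact: (oomega_pow_lt (a := OZero)).
by apply: oomega_pow_add => //; exact: S1.
Qed.

Lemma tower_add x y : olt x lam -> olt y lam -> olt (oadd x y) lam.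
Proof.
move=> xl yl; have [z [zl xz yz]] := @omax_ex (olt^~ lam) _ _ xl yl.
apply: (ole_olt_trans (oadd_le2 xz yz)).
have -> : oadd z z = omul z (onat 2) by rewrite /= add0o.
by apply: tower_mul => //; exact: onat_lt_tower.
Qed.

Lemma tower_succ x : olt x lam -> olt (OSucc x) lam.
Proof. by move=> xl; apply: (@tower_add x (onat 1)) => //; exact: onat_lt_tower. Qed.

Lemma tower_limit : olimit lam.
Proof. by split; [exact: oomega_pow_gt0 | exact: tower_succ]. Qed.

(** The new factor goes to the left because [szlenk_submult] strips the left factor of a product. *)
Definition opow x n := iter n (omul x) (onat 1).

Lemma tower_pow x n : olt x lam -> olt (opow x n) lam.
Proof.
move=> xl; elim: n => [|n IH]; first exact: onat_lt_tower.
exact: tower_mul.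
Qed.

Lemma tower_bound (I : eqType) (s : seq I) (f : I -> Ord) :
  (forall i, olt (f i) lam) ->
  exists2 z, olt z lam & forall i, i \in s -> ole (f i) z.
Proof.
move=> fl; elim: s => [|i s [z zl sz]]; first by exists OZero => //; exact: oomega_pow_gt0.
have [w [wl iw zw]] := @omax_ex (olt^~ lam) _ _ (fl i) zl.
exists w => // j; rewrite inE => /orP[/eqP->//|/sz jz].
exact: ole_trans jz zw.
Qed.

End MultiplicativelyIndecomposable.

Lemma opow_le x x' n n' : ole (onat 1) x' -> ole x x' -> (n <= n')%N ->
  ole (opow x n) (opow x' n').
Proof.
move=> x1 xx'; elim: n' n => [|n' IH] [|n] nn' //.
  by have := omul_le2 x1 (IH 0%N isT); rewrite (omul1 (onat 1)).
by apply: omul_le2 => //; exact: IH.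
Qed.

(** * Ordinals coding tuples in lexicographic order *)

Section Lexicographic.
Variable t : Ord.

(** [olex [:: r1; ...; rm]] is [t^(m-1) r1 + ... + t r(m-1) + rm]. *)
Definition olex_from acc s := foldl (fun acc r => oadd (omul t acc) r) acc s.
Definition olex := olex_from OZero.

(** Adding the same ordinal on the right need not keep a strict inequality, but a digit [r < t]
    does: [t acc + r < t (acc + 1) <= t acc']. *)
Lemma olex_from_lt acc acc' s :
  (forall j, (j < size s)%N -> olt (nth OZero s j) t) -> olt acc acc' ->
  olt (olex_from acc s) (olex_from acc' s).
Proof.
elim: s acc acc' => //= r s IH acc acc' h aa'.
apply: IH => [j|]; first exact: (h j.+1).
apply: olt_ole_trans (omul_lex aa' _) (ole_addr _ _).
exact: (h 0%N).
Qed.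

(** Supplies the descent in [admissible_not_szlenk], where one slot at a time receives a node of
    smaller rank. *)
Lemma olex_set_nth s i r : (forall j, (j < size s)%N -> olt (nth OZero s j) t) ->
  (i < size s)%N -> olt r (nth OZero s i) ->
  olt (olex (set_nth OZero s i r)) (olex s).
Proof.
move=> h is_ ri.
suff : forall acc, olt (olex_from acc (set_nth OZero s i r)) (olex_from acc s) by apply.
elim: s i h is_ ri => // u s IH [|i] h /= is_ ru acc.
  apply: olex_from_lt => [j|]; first exact: (h j.+1).
  exact: oadd_lt.
by apply: IH => // j; exact: (h j.+1).
Qed.

End Lexicographic.

Lemma tower_lex b t s : olt t (oomega_pow (oomega_pow b)) ->
  (forall j, (j < size s)%N -> olt (nth OZero s j) t) ->
  olt (olex t s) (oomega_pow (oomega_pow b)).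
Proof.
move=> tl h.
suff : forall acc, olt acc (oomega_pow (oomega_pow b)) ->
    olt (olex_from t acc s) (oomega_pow (oomega_pow b)).
  by apply; exact: oomega_pow_gt0.
elim: s h => //= r s IH h acc accl.
apply: IH => [j|]; first exact: (h j.+1).
apply: tower_add; first exact: tower_mul.
by apply: olt_trans tl; exact: (h 0%N).
Qed.

(** With [f] cofinal in [b] along [k <= w], the ordinals [w^(w^(f n) m) + m] are cofinal in
    [w^(w^b)]: bound [a] by [w^c n] with [c < w^b], then [c] by [w^d m] with [d < b], then [d] by
    some [f i]. *)
Lemma cofinal_tower b : countable_cofinality b ->
  exists e : nat -> nat -> Ord,
  [/\ forall n m, olt (e n m) (oomega_pow (oomega_pow b)),
      forall n m m', (m <= m')%N -> ole (e n m) (e n m')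
    & forall a, olt a (oomega_pow (oomega_pow b)) -> exists n m, ole a (e n m)].
Proof.
move=> [k [[f [fE fb fcof]] _] kw].
pose g n m := omul (oomega_pow (f (onat n))) (onat m).
(* The summand [onat m] takes care of finite [a]; it is all that is left for [n] not below [k], in
   particular when [b] is zero. *)
exists (fun n m => if `[< olt (onat n) k >] then oadd (oomega_pow (g n m)) (onat m)
                   else onat m); split.
- move=> n m; case: ifPn => [/asboolP nk|_]; last exact: onat_lt_tower.
  apply: tower_add (onat_lt_tower _ _); apply: oomega_pow_lt.
  by apply: olt_ole_trans (omul_onat_lt_pow _ _) _; exact/oomega_pow_le/fb.
- move=> n m m' mm'; case: ifPn => _; last exact: onat_le.
  apply: oadd_le2 (onat_le mm'); apply: oomega_pow_le.
  by apply: omul_le2 (ole_refl _) (onat_le mm').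
have fin a (n m : nat) : ole a (onat m) -> exists n m, ole a (if `[< olt (onat n) k >]
      then oadd (oomega_pow (g n m)) (onat m) else onat m).
  move=> am; exists n, m; apply: ole_trans am _; case: ifPn => _.
    exact: ole_addl.
  exact: ole_refl.
move=> a /olt_oomega_pow[a0|[c [n [cb an]]]]; first exact: (fin _ 0%N 0%N).
have [c0|[d [m [db cm]]]] := olt_oomega_pow cb.
  apply: (fin _ 0%N n); apply: ole_trans an _.
  apply: ole_trans (omul_le2 (oomega_pow_le c0) (ole_refl _)) _.
  by rewrite /= (omul_onat 1) mul1n; exact: ole_refl.
have [x xk dx] := fcof _ db.
(* Countable cofinality enters here: below [k <= w] there are only natural numbers, up to [oeq]. *)
have [i ix] : exists i, oeq x (onat i).
  have [i xi] := olt_ole_trans xk kw.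
  elim: i x {dx xk} xi => // i IH x.
  move=> xi; have [/IH//|ix] : olt x (onat i) \/ ole (onat i) x.
    by have [|] := ole_total (onat i) x; [right|left].
  by exists i; split.
have ik : olt (onat i) k by exact: ole_olt_trans ix.2 xk.
have {dx}di : ole d (f (onat i)) by exact: ole_trans dx (fE _ _ xk ix).1.
(* The [m.+1] comes from [w^c n < w^(c+1)] and [c + 1 <= w^(f i) m + 1 <= w^(f i) (m + 1)]. *)
exists i, (m.+1 + n)%N; case: ifPn => [_|/asboolP//].
apply: ole_trans (ole_addr _ _); apply: (ole_trans an).
apply: (ole_trans (olt_ole (omul_onat_lt_pow _ _))); apply: oomega_pow_le.
apply: (@ole_trans (omul (oomega_pow (f (onat i))) (onat m.+1))); last first.
  by apply: omul_le2 (ole_refl _) (onat_le _); exact: leq_addr.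
apply: (@ole_trans (oadd (omul (oomega_pow (f (onat i))) (onat m)) (onat 1))).
  apply: (ole_trans cm); apply: omul_le2 (ole_refl _); exact: oomega_pow_le.
by apply: oadd_le2 (ole_refl _) _; exact: oomega_pow_gt0.
Qed.

Local Open Scope classical_set_scope.
Local Open Scope ring_scope.

(** * Real and complex scalars *)

Section Scalars.
Context {R : realType} {k : scalar_kind}.
Local Notation K := (scalars R k).
Local Notation md := (@modulus R k).

Definition of_real : R -> K :=
  match k return R -> scalars R k with
  | RealScalars => id
  | ComplexScalars => fun r => r%:C%C
  end.

Lemma of_realD a b : of_real (a + b) = of_real a + of_real b.
Proof. by rewrite /of_real; case: k => //; rewrite rmorphD. Qed.

Lemma of_realM a b : of_real (a * b) = of_real a * of_real b.
Proof. by rewrite /of_real; case: k => //; rewrite rmorphM. Qed.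

Lemma of_real0 : of_real 0 = 0. Proof. by rewrite /of_real; case: k. Qed.

Lemma of_real1 : of_real 1 = 1. Proof. by rewrite /of_real; case: k. Qed.

Lemma ler_of_real a b : (of_real a <= of_real b) = (a <= b).
Proof. by rewrite /of_real; case: k => //; rewrite lecR. Qed.

Lemma ltr_of_real a b : (of_real a < of_real b) = (a < b).
Proof. by rewrite /of_real; case: k => //; rewrite ltcR. Qed.

Lemma of_real_inj : injective of_real.
Proof.
by move=> a b ab; apply/eqP; rewrite eq_le -!ler_of_real ab lexx.
Qed.

Lemma norm_modulus (z : K) : `|z| = of_real (md z).
Proof.
rewrite /of_real /modulus; case: k z => //= z.
Qed.

Lemma modulus_ge0 z : 0 <= md z.
Proof. by rewrite -ler_of_real of_real0 -norm_modulus normr_ge0. Qed.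

Lemma modulus0 : md 0 = 0.
Proof. by apply/of_real_inj; rewrite -norm_modulus normr0 of_real0. Qed.

Lemma modulus1 : md 1 = 1.
Proof. by apply/of_real_inj; rewrite -norm_modulus normr1 of_real1. Qed.

Lemma modulusM z w : md (z * w) = md z * md w.
Proof.
by apply/of_real_inj; rewrite of_realM -!norm_modulus normrM.
Qed.

Lemma modulusN z : md (- z) = md z.
Proof. by apply/of_real_inj; rewrite -!norm_modulus normrN. Qed.

Lemma ler_modulusD z w : md (z + w) <= md z + md w.
Proof. by rewrite -ler_of_real of_realD -!norm_modulus ler_normD. Qed.

Lemma modulus_eq0 z : md z = 0 -> z = 0.
Proof.
by move=> z0; apply/normr0_eq0; rewrite norm_modulus z0 of_real0.
Qed.

Lemma modulusV z : md z^-1 = (md z)^-1.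
Proof.
have [->|z0] := eqVneq z 0; first by rewrite invr0 modulus0 invr0.
have mz : md z != 0 by apply: contraNneq z0 => /modulus_eq0->.
by apply: (mulfI mz); rewrite -modulusM !divff// modulus1.
Qed.

Lemma modulus_of_real a : 0 <= a -> md (of_real a) = a.
Proof.
move=> a0; apply/of_real_inj; rewrite -norm_modulus ger0_norm//.
by rewrite -of_real0 ler_of_real.
Qed.

Lemma modulus_phase z : exists2 u, md u = 1 & u * z = of_real (md z).
Proof.
have [->|z0] := eqVneq z 0; first by exists 1; rewrite ?modulus1 ?mul1r ?modulus0 ?of_real0.
exists (`|z| / z); last by rewrite divfK// norm_modulus.
apply/of_real_inj; rewrite -norm_modulus normrM normr_id normfV divff ?of_real1//.
by rewrite normr_eq0.
Qed.

Lemma pos_of_real (e : K) : 0 < e -> exists2 r, 0 < r & e = of_real r.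
Proof.
move=> e0; have ee : e = of_real (md e) by rewrite -norm_modulus gtr0_norm.
by exists (md e) => //; rewrite -ltr_of_real -ee of_real0.
Qed.

Lemma ler_modulus_sum (I : Type) (r : seq I) (P : pred I) (F : I -> K) :
  md (\sum_(i <- r | P i) F i) <= \sum_(i <- r | P i) md (F i).
Proof.
elim/big_rec2: _ => [|i y1 y2 _ h]; first by rewrite modulus0.
by apply: (le_trans (ler_modulusD _ _)); rewrite lerD2l.
Qed.

End Scalars.


(** In the complex case the compact set is a square, the continuous image of a product of two
    segments. *)
Lemma disk_sub_compact (R : realType) (k : scalar_kind) (r : R) :
  exists2 C : set (scalars R k), compact C & [set z | modulus z <= r] `<=` C.
Proof.
case: k.
  exists `[- r, r]%classic; first exact: segment_compact.
  by move=> z /=; rewrite in_itv/= ler_norml.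
pose K := scalars R ComplexScalars.
pose oR : R -> K := @of_real R ComplexScalars.
pose g (p : R * R) : K := (p.1 +i* p.2)%C.
have gc : continuous g.
  move=> p; apply/cvgrPdist_le => /= e /pos_of_real[d d0 ->].
  have d2 : 0 < d / 2 by rewrite divr_gt0.
  near=> q.
  rewrite norm_modulus ler_of_real.
  have -> : g p - g q = oR (p.1 - q.1) + ('i%C : K) * oR (p.2 - q.2).
    by rewrite /oR /of_real /g; simpc.
  apply: (le_trans (ler_modulusD _ _)); rewrite [leRHS](splitr d) modulusM.
  have mC (x : R) : modulus (oR x) = `|x|.
    by rewrite /modulus /oR /of_real normc_def /= expr0n addr0 sqrtr_sqr.
  have -> : modulus ('i%C : K) = 1.
    by rewrite /modulus normc_def /= expr0n expr1n add0r sqrtr1.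
  have [p1 p2] : ball p (d / 2) q by near: q; exact: (nbhsx_ballx p _ d2).
  by rewrite mul1r !mC; apply: lerD; apply: ltW.
exists (g @` (`[- r, r]%classic `*` `[- r, r]%classic)).
  apply: continuous_compact; first exact: continuous_subspaceT.
  by apply: compact_setX; exact: segment_compact.
move=> [a b] h; exists (a, b) => //=.
have {h}h : Num.sqrt (a ^+ 2 + b ^+ 2) <= r by [].
rewrite !in_itv/= -!ler_norml -!sqrtr_sqr; split; apply: le_trans h;
  by rewrite ler_wsqrtr// ?lerDl ?lerDr sqr_ge0.
Unshelve. all: by end_near. Qed.

Lemma modulus_le_lim (R : realType) (k : scalar_kind) (F : set_system (scalars R k))
    (FF : ProperFilter F) (l : scalars R k) (r : R) :
  F --> l -> F [set z | modulus z <= r] -> modulus l <= r.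
Proof.
move=> Fl Fr; apply/ler_addgt0Pr => e e0.
have eK : 0 < of_real e :> scalars R k by rewrite -of_real0 ltr_of_real.
move/cvgrPdist_le/(_ _ eK) : Fl => Fl.
have [z []] := filter_ex (filterI Fr Fl).
rewrite /= norm_modulus ler_of_real => zr lz.
by rewrite -(subrK z l) addrC; apply: (le_trans (ler_modulusD _ _)); exact: lerD.
Qed.

(** A Cauchy filter contains a disk of radius [1], which lies in a compact set. *)
Lemma scalars_cauchy_cvg (R : realType) (k : scalar_kind) (F : set_system (scalars R k)) :
  ProperFilter F -> cauchy F -> cvg F.
Proof.
move=> FF Fc.
have /cauchyP/(_ 1 ltr01)[x Fx] := Fc.
have [C Cc DC] := disk_sub_compact k (modulus x + 1).
apply: (@compact_cauchy_cvg _ C) => //; apply: filterS Fx => z xz; apply: DC => /=.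
rewrite -(subrK x z) addrC; apply: (le_trans (ler_modulusD _ _)).
rewrite lerD2l -(@ler_of_real _ k) -norm_modulus of_real1 distrC; exact: ltW.
Qed.

(** * Combinatorial Banach spaces *)

(** Finite sets over which moduli are summed, each listed without repetition; the singletons make
    the norm dominate every coordinate. *)
Record family (G : eqType) := Family {
  fam_set :> seq G -> Prop;
  fam_nil : fam_set [::];
  fam1 : forall t, fam_set [:: t];
  fam_uniq : forall s, fam_set s -> uniq s
}.

Section TailSum.
Context {R : realType} {k : scalar_kind} {G : eqType}.
Local Notation K := (scalars R k).

Definition tail_sum (l s : seq G) (y : G -> K) : R :=
  \sum_(t <- s | t \notin l) modulus (y t).

Lemma tail_sum_ge0 l s y : 0 <= tail_sum l s y.
Proof. by apply: sumr_ge0 => t _; exact: modulus_ge0. Qed.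

Lemma tail_sumD l s y z : tail_sum l s (y + z) <= tail_sum l s y + tail_sum l s z.
Proof. by rewrite -big_split; apply: ler_sum => t _; exact: ler_modulusD. Qed.

Lemma tail_sumZ l s a y : tail_sum l s (a *: y) = modulus a * tail_sum l s y.
Proof. by rewrite /tail_sum mulr_sumr; apply: eq_bigr => t _; rewrite -modulusM. Qed.

Lemma tail_sum_sub l l' s y :
  {subset l <= l'} -> tail_sum l' s y <= tail_sum l s y.
Proof.
move=> ll'; rewrite /tail_sum big_mkcond [leRHS]big_mkcond.
apply: ler_sum => t _; have [|_] := boolP (t \notin l').
  by move=> tl'; rewrite (contra (@ll' t)).
by case: ifP => // _; exact: modulus_ge0.
Qed.

Lemma tail_sum_nil s y : tail_sum [::] s y = \sum_(t <- s) modulus (y t).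
Proof. by []. Qed.

Lemma tail_sum0 l s : tail_sum l s 0 = 0.
Proof. by apply: big1 => t _; exact: modulus0. Qed.

End TailSum.

Section CombSpace.
Context {R : realType} {k : scalar_kind} {G : eqType}.
Local Notation K := (scalars R k).
Variable S : family G.

(** The finitely supported functions are dense for the norm given by the
    supremum over [S] of the sums of moduli exactly when its tails vanish; for
    [S] the family of all duplicate-free sequences this is [l_1]. *)
Definition comb_pred : pred (G -> K) := fun y => `[<
  (exists c, forall s, S s -> tail_sum [::] s y <= c) /\
  forall e : R, 0 < e -> exists l, forall s, S s -> tail_sum l s y <= e >].

Lemma comb_submod : submod_closed comb_pred.
Proof.
split=> [|a y z /asboolP[[c yc] yl] /asboolP[[d zd] zl]]; apply/asboolP.
  by split=> [|e e0]; [exists 0 | exists [::]] => s _; rewrite tail_sum0// ltW.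
split.
  exists (modulus a * c + d) => s Ss; apply: (le_trans (tail_sumD _ _ _ _)).
  by rewrite tail_sumZ lerD ?zd// ler_wpM2l ?yc// modulus_ge0.
move=> e e0; have e2 : 0 < e / 2 by rewrite divr_gt0.
(* Adding [1] keeps the divisor positive when [a] is zero. *)
have a1 : 0 < modulus a + 1 by rewrite ltr_wpDl// modulus_ge0.
have [l h] := yl _ (divr_gt0 e2 a1); have [l' h'] := zl _ e2.
exists (l ++ l') => s Ss; apply: (le_trans (tail_sumD _ _ _ _)).
rewrite [leRHS](splitr e) lerD//; last first.
  by apply: le_trans (h' s Ss); apply: tail_sum_sub => t; rewrite mem_cat orbC => ->.
rewrite tail_sumZ.
have {h}h : tail_sum (l ++ l') s y <= e / 2 / (modulus a + 1).
  by apply: le_trans (h s Ss); apply: tail_sum_sub => t; rewrite mem_cat => ->.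
rewrite -[leRHS](@divfK _ (modulus a + 1)) ?gt_eqF// mulrC.
by rewrite ler_pM ?tail_sum_ge0 ?modulus_ge0 ?lerDl.
Qed.

HB.instance Definition _ := GRing.isSubmodClosed.Build K (G -> K) comb_pred
  comb_submod.

Record comb_space := Comb { comb_val :> G -> K; comb_valP : comb_val \in comb_pred }.

HB.instance Definition _ := [isSub for comb_val].
HB.instance Definition _ := [Choice of comb_space by <:].
HB.instance Definition _ := [SubChoice_isSubLmodule of comb_space by <:].

Implicit Types y z : comb_space.

Definition comb_norm y : R := sup [set tail_sum [::] s y | s in (S : set _)].

Lemma comb_has_sup y : has_sup [set tail_sum [::] s y | s in (S : set _)].
Proof.
split; first by exists (tail_sum [::] [::] y), [::] => //; exact: fam_nil.
have /asboolP[[c h] _] := comb_valP y.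
by exists c => _ [s Ss <-]; exact: h.
Qed.

Lemma tail_sum_le_norm y s : S s -> tail_sum [::] s y <= comb_norm y.
Proof. by move=> Ss; apply: (sup_upper_bound (comb_has_sup y)); exists s. Qed.

Lemma comb_norm_le y c : (forall s, S s -> tail_sum [::] s y <= c) -> comb_norm y <= c.
Proof.
move=> h; apply: ge_sup; first by case: (comb_has_sup y).
by move=> _ [s Ss <-]; exact: h.
Qed.

Lemma comb_norm_ge0 y : 0 <= comb_norm y.
Proof. exact: le_trans (tail_sum_ge0 _ _ _) (tail_sum_le_norm y (fam_nil S)). Qed.

Lemma modulus_le_norm y t : modulus (y t) <= comb_norm y.
Proof.
by have := tail_sum_le_norm y (fam1 S t); rewrite /tail_sum big_seq1.
Qed.

Lemma comb_normD y z : of_real (comb_norm (y + z)) <=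
  of_real (comb_norm y) + of_real (comb_norm z) :> K.
Proof.
rewrite -of_realD ler_of_real; apply: comb_norm_le => s Ss.
apply: (le_trans (tail_sumD _ _ _ _)).
by apply: lerD; exact: tail_sum_le_norm.
Qed.

Lemma comb_normZ (a : K) y : of_real (comb_norm (a *: y)) =
  `|a| * of_real (comb_norm y) :> K.
Proof.
rewrite norm_modulus -of_realM; congr of_real; apply/eqP.
rewrite eq_le; apply/andP; split.
  apply: comb_norm_le => s Ss.
  by rewrite tail_sumZ ler_wpM2l ?modulus_ge0 ?tail_sum_le_norm.
have [->|a0] := eqVneq a 0; first by rewrite modulus0 mul0r comb_norm_ge0.
have ma : 0 < modulus a.
  rewrite lt_neqAle modulus_ge0 andbT eq_sym; apply/eqP => /modulus_eq0 a00.
  by rewrite a00 eqxx in a0.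
rewrite -ler_pdivlMl//; apply: comb_norm_le => s Ss.
by rewrite ler_pdivlMl// -tail_sumZ; apply: (@tail_sum_le_norm (a *: y)).
Qed.

Lemma comb_norm0_eq0 y : of_real (comb_norm y) = 0 :> K -> y = 0.
Proof.
rewrite -of_real0 => /of_real_inj y0; apply/val_inj/funext => t /=.
by apply: modulus_eq0; apply/eqP; rewrite eq_le modulus_ge0 -y0 modulus_le_norm.
Qed.

HB.instance Definition _ :=
  Lmodule_isNormed.Build K comb_space comb_normD comb_normZ comb_norm0_eq0.

Lemma comb_subE y z t : (y - z) t = y t - z t.
Proof. by []. Qed.

Lemma comb_scaleE (a : K) y t : (a *: y) t = a * y t.
Proof. by []. Qed.

Lemma normE y : `|y| = of_real (comb_norm y).
Proof. by []. Qed.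

End CombSpace.

Lemma filter_all_seq (T : Type) (F : set_system T) (FF : Filter F) (I : eqType)
    (s : seq I) (P : I -> set T) :
  (forall i, F (P i)) -> F [set x | forall i, i \in s -> P i x].
Proof.
move=> FP; elim: s => [|i s IH]; first by apply: filterS filterT.
apply: filterS (filterI (FP i) IH) => x [xi xs] j.
by rewrite inE => /orP[/eqP->//|]; exact: xs.
Qed.

(** * Completeness, unit vectors and finitely supported approximation *)

Section Complete.
Context {R : realType} {k : scalar_kind} {G : eqType}.
Local Notation K := (scalars R k).
Variable S : family G.
Local Notation X := (@comb_space R k G S).

(** The limit is taken coordinatewise. It lies in the space because its tails are bounded by those
    of some [x] plus the uniformly small sums of [L - x]. *)
Lemma comb_cauchy_cvg (F : set_system X) : ProperFilter F -> cauchy F -> cvg F.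
Proof.
move=> FF /cauchyP Fc.
have Fe e : 0 < e -> exists x : X, F [set y | comb_norm (x - y) < e].
  move=> e0; have eK : 0 < of_real e :> K by rewrite -of_real0 ltr_of_real.
  have [x Fx] := Fc _ eK; exists x; apply: filterS Fx => y.
  by rewrite -ball_normE /= normE ltr_of_real.
have /choice[L FL] t : exists l : K, (fun y : X => y t) @ F --> l.
  apply/cvg_ex; apply: scalars_cauchy_cvg; apply/cauchyP => e /pos_of_real[d d0 ->].
  have [x Fx] := Fe _ d0; exists (x t).
  suff : F [set y : X | ball (x t) (of_real d) (y t)] by [].
  apply: filterS Fx => y xy; rewrite -ball_normE /= norm_modulus ltr_of_real; apply: le_lt_trans xy.
  rewrite -comb_subE; exact: modulus_le_norm.
(* For fixed [s] only finitely many coordinates matter, so some [y] close to [x] in norm is also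
   close to [L] on [s]. Each coordinate is allowed an error [d / (size s + 1)], the [+ 1] being for
   empty [s]. *)
have key e x : F [set y : X | comb_norm (x - y) < e] ->
    forall s, S s -> tail_sum [::] s (L - x) <= e.
  move=> Fx s Ss; apply/ler_addgt0Pr => d d0.
  have d1 : 0 < d / (size s).+1%:R by rewrite divr_gt0.
  have Fd t : F [set y : X | modulus (L t - y t) <= d / (size s).+1%:R].
    have eK : 0 < of_real (d / (size s).+1%:R) :> K by rewrite -of_real0 ltr_of_real.
    have /cvgrPdist_le/(_ _ eK) := FL t.
    by apply: filterS => y; rewrite /= norm_modulus ler_of_real.
  have [y [yx yL]] := filter_ex (filterI Fx (filter_all_seq _ s Fd)).
  rewrite (_ : L - x = - ((x - y : X) : G -> K) + (L - y)); last first.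
    apply/funext => t; rewrite -[RHS]/(- (x t - y t) + (L t - y t)).
    by rewrite opprB [RHS]addrC addrA addrNK.
  apply: (le_trans (tail_sumD _ _ _ _)); apply: lerD.
    rewrite -scaleN1r tail_sumZ modulusN modulus1 mul1r.
    exact: le_trans (tail_sum_le_norm _ Ss) (ltW yx).
  apply: (@le_trans _ _ (\sum_(t <- s) d / (size s).+1%:R)).
    by rewrite tail_sum_nil big_seq [leRHS]big_seq; apply: ler_sum => t; exact: yL.
  rewrite big_const_seq count_predT iter_addr_0 -[leLHS]mulr_natr.
  by rewrite mulrAC ler_pdivrMr// ler_wpM2l ?ltW// ltr_nat.
have LP : L \in comb_pred S.
  have LE (x : X) : L = (L - x) + x by rewrite subrK.
  apply/asboolP; split.
    have [x /key h] := Fe 1 ltr01; exists (1 + comb_norm x) => s Ss.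
    rewrite (LE x); apply: (le_trans (tail_sumD _ _ _ _)).
    by rewrite lerD ?h ?tail_sum_le_norm.
  move=> e e0; have e2 : 0 < e / 2 by rewrite divr_gt0.
  have [x /key h] := Fe _ e2; have /asboolP[_ /(_ _ e2)[l xl]] := comb_valP x.
  exists l => s Ss; rewrite (LE x); apply: (le_trans (tail_sumD _ _ _ _)).
  rewrite [leRHS](splitr e) lerD ?xl//; apply: le_trans (h s Ss).
  exact: tail_sum_sub.
apply/cvg_ex; exists (Comb LP); apply/cvgrPdist_lt => e /pos_of_real[d d0 ->].
have d2 : 0 < d / 2 by rewrite divr_gt0.
have [x Fx] := Fe _ d2; apply: filterS (Fx) => y xy.
rewrite normE ltr_of_real -[Comb LP](subrK x) -addrA.
rewrite -(ltr_of_real (k := k)); apply: (le_lt_trans (comb_normD _ _)).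
rewrite -of_realD ltr_of_real [ltRHS](splitr d) ler_ltD//.
by apply: comb_norm_le => s Ss; exact: (key _ _ Fx).
Qed.

HB.instance Definition _ := Uniform_isComplete.Build X comb_cauchy_cvg.

Lemma tail_sum_delta s t : S s -> tail_sum [::] s (fun u => (u == t)%:R : K) <= 1.
Proof.
move=> Ss; have us := fam_uniq Ss.
rewrite tail_sum_nil (_ : \sum_(u <- s) _ = \sum_(u <- s | u == t) 1); last first.
  rewrite [RHS]big_mkcond; apply: eq_bigr => u _.
  by case: (u == t); rewrite ?modulus1 ?modulus0.
by rewrite big_const_seq iter_addr_0 count_uniq_mem// lern1 leq_b1.
Qed.

Lemma unit_vec_subproof t : (fun u => (u == t)%:R : K) \in comb_pred S.
Proof.
apply/asboolP; split; first by exists 1 => s; exact: tail_sum_delta.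
move=> e e0; exists [:: t] => s Ss; rewrite /tail_sum big1 ?ltW// => u.
by rewrite inE => /negPf->; rewrite modulus0.
Qed.

Definition unit_vec t : X := Comb (unit_vec_subproof t).

Lemma unit_vecE t u : unit_vec t u = (u == t)%:R.
Proof. by []. Qed.

Lemma unit_vec_norm t : comb_norm (unit_vec t) <= 1.
Proof. by apply: comb_norm_le => s; exact: tail_sum_delta. Qed.

Definition restr (l : seq G) (y : X) : X := \sum_(t <- undup l) y t *: unit_vec t.

Lemma comb_sumE (I : Type) (r : seq I) (P : pred I) (f : I -> X) u :
  (\sum_(i <- r | P i) f i) u = \sum_(i <- r | P i) f i u.
Proof. by elim/big_rec2: _ => // i x y _ <-. Qed.

Lemma restrE l y u : restr l y u = if u \in l then y u else 0.
Proof.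
rewrite comb_sumE -mem_undup; have := undup_uniq l.
elim: (undup l) => [|t s IH]; first by rewrite big_nil.
rewrite big_cons inE cons_uniq => /andP[ts us]; rewrite IH//.
rewrite comb_scaleE unit_vecE.
have [->|ut] := eqVneq u t; first by rewrite (negPf ts) addr0 mulr1.
by rewrite mulr0 add0r.
Qed.

Lemma restr_approx (y : X) (e : R) : 0 < e ->
  exists l, comb_norm (y - restr l y) <= e.
Proof.
move=> e0; have /asboolP[_ /(_ _ e0)[l h]] := comb_valP y.
exists l; apply: comb_norm_le => s Ss; apply: le_trans (h s Ss).
rewrite /tail_sum [leRHS]big_mkcond; apply: ler_sum => t _.
rewrite comb_subE restrE.
by case: (t \in l); rewrite ?subr0// subrr modulus0.
Qed.

End Complete.

Section Functionals.
Context {R : realType} {k : scalar_kind}.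
Local Notation K := (scalars R k).

Lemma nearly_modulusP (E F : normedModType K) (f : {linear E -> F}) (c : R) :
  0 <= c -> (forall x, `|f x| <= of_real c * `|x|) -> bounded_near f (nbhs 0).
Proof.
move=> c0 h; apply/linear_boundedP; exists (of_real c); split.
  by apply: ger0_real; rewrite -of_real0 ler_of_real.
by move=> r cr x; apply: (le_trans (h x)); rewrite ler_wpM2r// ltW.
Qed.

Lemma operator_bound (E F : normedModType K) (T : operator E F) :
  exists2 c : R, 0 < c & forall x, `|T x| <= of_real c * `|x|.
Proof.
have /linear_boundedP/pinfty_ex_gt0[M M0 h] := op_bounded T.
by have [c c0 cM] := pos_of_real M0; exists c => // x; rewrite -cM.
Qed.

End Functionals.

(** * Weak-star topology and Szlenk derivatives *)

Section WeakStar.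
Context {R : realType} {k : scalar_kind}.
Local Notation K := (scalars R k).
Implicit Types (E : normedModType K).

Definition real_norm E (x : E) : R := modulus (`|x| : K).

Lemma real_normE E (x : E) : `|x| = of_real (real_norm x).
Proof. by rewrite -norm_modulus normr_id. Qed.

Lemma real_norm_ge0 E (x : E) : 0 <= real_norm x.
Proof. exact: modulus_ge0. Qed.

Lemma real_norm_le1 E (x : E) : (`|x| <= 1) = (real_norm x <= 1).
Proof. by rewrite real_normE -of_real1 ler_of_real. Qed.

Lemma functional_bounded E (f : {linear E -> K^o}) (c : R) : 0 <= c ->
  (forall x, modulus (f x : K) <= c * real_norm x) -> bounded_near f (nbhs 0).
Proof.
move=> c0 h; apply: (@nearly_modulusP R k E K^o f c c0) => x.
rewrite [`|x|]real_normE -of_realM; apply: (@le_trans _ _ (of_real (modulus (f x : K)))).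
  by rewrite -norm_modulus.
by rewrite ler_of_real.
Qed.

Definition mk_linear E (f : E -> K^o) (fl : linear f) : {linear E -> K^o} :=
  HB.pack_for {linear E -> K^o} f (GRing.isLinear.Build K E K^o *:%R f fl).

Definition mk_functional E (f : E -> K^o) (fl : linear f) (c : R) (c0 : 0 <= c)
    (h : forall x, modulus (f x : K) <= c * real_norm x) : dual_space E :=
  @Operator K E K^o (mk_linear fl) (@functional_bounded E (mk_linear fl) c c0 h).

Lemma eval_continuous E (x : E) :
  continuous (fun f : weak_star E => (f : dual_space E) x : K^o).
Proof.
pose coe (f : weak_star E) : {ptws E -> K^o} := (f : dual_space E) : E -> K^o.
have cc : continuous coe by exact: initial_continuous.
move=> f; have := cc f.
by rewrite -[continuous_at _ _]/({ptws, coe @ nbhs f --> coe f}) => /pointwise_cvgP/(_ x).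
Qed.

Lemma weak_star_cvg E (F : set_system (weak_star E)) (g : weak_star E) :
  Filter F ->
  (forall x, (fun f : weak_star E => (f : dual_space E) x : K^o) @ F -->
     ((g : dual_space E) x : K^o)) -> F --> g.
Proof.
move=> FF h; pose coe (f : weak_star E) : {ptws E -> K^o} := (f : dual_space E) : E -> K^o.
have FC : {ptws, coe @ F --> coe g} by apply/pointwise_cvgP => x; exact: h.
move=> A; rewrite nbhsE => -[_ [[C oC <-] Cg] CA].
apply: filterS CA _; apply: FC; exact: open_nbhs_nbhs.
Qed.

Lemma dual_ballP E (f : dual_space E) :
  dual_ball f <-> forall x, modulus (f x) <= real_norm x.
Proof.
split=> [|h]; last first.
  apply/ereal_supP => _ [x /= x1 <-]; rewrite lee_fin; apply: le_trans (h x) _.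
  by rewrite -real_norm_le1.
move=> /ereal_supP h x.
have [x0|x0] := eqVneq (real_norm x) 0.
  have -> : x = 0 by apply: normr0_eq0; rewrite real_normE x0 of_real0.
  by rewrite linear0 modulus0 real_norm_ge0.
have rx : 0 < real_norm x by rewrite lt_neqAle eq_sym x0 real_norm_ge0.
have rK : of_real (real_norm x) != 0 :> K by rewrite -of_real0 (inj_eq of_real_inj).
pose y := (of_real (real_norm x))^-1 *: x.
have y1 : `|y| <= 1.
  by rewrite normrZ normfV norm_modulus modulus_of_real ?real_norm_ge0// real_normE mulVf.
have /h : [set (modulus (f x))%:E | x in [set x : E | `|x| <= 1]] (modulus (f y))%:E by exists y.
have {1}-> : x = of_real (real_norm x) *: y by rewrite scalerA divff// scale1r.
rewrite lee_fin => fy.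
rewrite linearZ /= [X in modulus X]/(_ * _) modulusM modulus_of_real ?real_norm_ge0//.
by rewrite ler_piMr ?real_norm_ge0.
Qed.

(** Banach-Alaoglu. Along an ultrafilter on the ball every value [f x] stays in a compact set, hence
    converges; the limits form a linear functional of norm at most one. *)
Lemma weak_star_compact_ball E : compact (@dual_ball R k E : set (weak_star E)).
Proof.
rewrite compact_ultra => F FU FB.
have FF : ProperFilter F by exact: ultra_proper.
pose ev x (f : weak_star E) : K := (f : dual_space E) x.
have /choice[l lF] x : exists l : K, ev x @ F --> l.
  have [C Cc DC] := disk_sub_compact k (real_norm x).
  have FC : F [set f | C (ev x f)].
    apply: filterS FB => f /dual_ballP/(_ x) fx; exact: DC.
  have [l [_ lC]] := Cc _ (fmap_proper_filter (ev x) FF) FC.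
  (* A cluster point of an ultrafilter is a limit: the complement of a neighbourhood cannot belong
     to it. *)
  exists l => N Nl; have [//|NF] := in_ultra_setVsetC (ev x @^-1` N) FU.
  by have [y []] := lC (~` N) N NF Nl.
have l_lin : linear (l : E -> K^o).
  move=> a x y; apply: (@cvg_unique _ (@norm_hausdorff _ K^o) (ev (a *: x + y) @ F)) => //.
    exact: lF.
  have -> : ev (a *: x + y) = (fun f => a *: (ev x f : K^o) + ev y f).
    by apply/funext => f; rewrite /ev linearP.
  by apply: cvgD; [apply: cvgZr; exact: lF | exact: lF].
have l_bnd x : modulus (l x) <= 1 * real_norm x.
  rewrite mul1r; apply: (modulus_le_lim _ (lF x)).
  suff : F [set f | modulus (ev x f) <= real_norm x] by [].
  by apply: filterS FB => f /dual_ballP; exact.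
exists (mk_functional l_lin ler01 l_bnd); split.
  by apply/dual_ballP => x; have := l_bnd x; rewrite mul1r.
by apply: weak_star_cvg => x; exact: lF.
Qed.

Lemma dual_distP E (f g : dual_space E) (e : R) :
  (e%:E < dual_dist f g)%E <->
  exists2 x : E, `|x| <= 1 & e < modulus (f x - g x).
Proof.
split=> [/ereal_sup_gtP[_ [x x1 <-]]|[x x1 ex]].
  by rewrite lte_fin => ex; exists x.
by apply/ereal_sup_gtP; exists (modulus (f x - g x))%:E; rewrite ?lte_fin//; exists x.
Qed.

Lemma diamP E (A : set (dual_space E)) (e : R) :
  (e%:E < diam A)%E <-> exists f g, [/\ A f, A g & (e%:E < dual_dist f g)%E].
Proof.
split=> [/ereal_sup_gtP[_ [[f g] [/= Af Ag] <-] efg]|[f [g [Af Ag efg]]]].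
  by exists f, g.
by apply/ereal_sup_gtP; exists (dual_dist f g) => //; exists (f, g).
Qed.

End WeakStar.

Section SzlenkIter.
Context {R : realType} {k : scalar_kind}.
Local Notation K := (scalars R k).
Implicit Types (E : normedModType K).

Lemma szlenk_iter_sub E (e : R) (A : set (dual_space E)) a :
  szlenk_iter e A a `<=` A.
Proof. exact: (@szlenk_iter_anti R k E e A OZero). Qed.

Lemma szlenk_iterD E (e : R) (A : set (dual_space E)) a b :
  szlenk_iter e A (oadd a b) = szlenk_iter e (szlenk_iter e A a) b.
Proof.
elim: b => //= [b ->//|I i0 f IH].
by rewrite eqEsubset; split=> g h i; [rewrite -IH | rewrite IH].
Qed.

(** The preimage of a neighbourhood of [psi f] is a neighbourhood of [f]; two points in it more than
    [e] apart have images more than [e'] apart. *)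
Lemma szlenk_iter_map E E' (psi : dual_space E -> dual_space E')
    (A : set (dual_space E)) (A' : set (dual_space E')) (e e' : R) :
  continuous (psi : weak_star E -> weak_star E') ->
  (forall f, A f -> A' (psi f)) ->
  (forall f g, A f -> A g -> (e%:E < dual_dist f g)%E ->
    (e'%:E < dual_dist (psi f) (psi g))%E) ->
  forall a f, szlenk_iter e A a f -> szlenk_iter e' A' a (psi f).
Proof.
move=> cpsi AA' dd; elim=> [|a IH|I i0 h IH] f /=; first exact: AA'.
- move=> [af df]; split=> [|V oV Vf]; first exact: IH.
  have /diamP[g [h [[ag Vg] [ah Vh] gh]]] :=
    df _ (open_comp (fun x _ => cpsi x) oV) Vf.
  apply/diamP; exists (psi g), (psi h); split; [by split=> //; exact: IH..|].
  by apply: dd => //; exact: szlenk_iter_sub ag || exact: szlenk_iter_sub ah.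
- by move=> hf i; exact: IH.
Qed.

(** Derivation is local: at a point of [V] the test neighbourhoods may be cut down to subsets of
    [V]. *)
Lemma szlenk_iter_local E (e : R) (A : set (dual_space E)) (V : set (weak_star E)) a :
  open V -> szlenk_iter e A a `&` V `<=` szlenk_iter e (A `&` V) a.
Proof.
move=> oV; elim: a => [|a IH|I i0 h IH] // f /= [].
- move=> [af df] Vf; split=> [|W oW Wf]; first exact: IH.
  have /diamP[g [h [[ag [Wg Vg]] [ah [Wh Vh]] gh]]] := df _ (openI oW oV) (conj Wf Vf).
  by apply/diamP; exists g, h; split=> //; split=> //; exact: IH.
- by move=> hf Vf i; exact: IH.
Qed.

(** An open set around a limit point of the derived set is also an open set around some point of it,
    so its trace already has large diameter. *)
Lemma closed_szlenk_iter E (e : R) (A : set (dual_space E)) a :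
  closed (A : set (weak_star E)) ->
  closed (szlenk_iter e A a : set (weak_star E)).
Proof.
move=> cA; elim: a => [//|a IH|I i0 h IH] /=; last first.
  suff -> : [set g | forall i, szlenk_iter e A (h i) g] =
      \bigcap_i (szlenk_iter e A (h i) : set (weak_star E)).
    by apply: closed_bigI => i _; exact: IH.
  by rewrite eqEsubset; split=> [g hg i _|g hg i]; exact: hg.
move=> f clf; have af : szlenk_iter e A a f.
  by apply: IH => U /clf[g [[ag _] Ug]]; exists g.
split=> // V oV Vf; have [g [[_ dg] Vg]] := clf V (open_nbhs_nbhs (conj oV Vf)).
exact: dg.
Qed.

End SzlenkIter.

(** * Submultiplicativity and compactness for the Szlenk index *)

Section Submultiplicative.
Context {R : realType} {k : scalar_kind}.
Local Notation K := (scalars R k).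

Lemma functional_bound (E : normedModType K) (f : dual_space E) :
  exists2 c : R, 0 <= c & forall x, modulus (f x : K) <= c * real_norm x.
Proof.
have [c c0 h] := operator_bound f; exists c; first exact: ltW.
move=> x; rewrite -(@ler_of_real R k) of_realM -real_normE -norm_modulus; exact: h.
Qed.

Lemma affine_subproof (E : normedModType K) (a : K) (f g : dual_space E) :
  exists h : dual_space E, forall x, (h x : K) = a * (g x - f x).
Proof.
have [c c0 fc] := functional_bound f; have [d d0 gd] := functional_bound g.
have lin : linear ((fun x => a * (g x - f x)) : E -> K^o).
  move=> u x y.
  have gP : g (u *: x + y) = u * g x + g y :> K by exact: linearP.
  have fP : f (u *: x + y) = u * f x + f y :> K by exact: linearP.
  rewrite gP fP -[RHS]/(u * (a * (g x - f x)) + a * (g y - f y)).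
  by rewrite opprD addrACA -mulrBr mulrDr mulrCA.
have b0 : 0 <= modulus a * (d + c) by rewrite mulr_ge0 ?modulus_ge0 ?addr_ge0.
have bnd x : modulus (a * (g x - f x)) <= modulus a * (d + c) * real_norm x.
  rewrite modulusM -mulrA ler_wpM2l ?modulus_ge0// mulrDl.
  by apply: (le_trans (ler_modulusD _ _)); rewrite modulusN lerD ?fc ?gd.
by exists (mk_functional lin b0 bnd).
Qed.

(** With [a = 1/d] this rescaling carries the functionals within distance [d] of [f] into the unit
    ball. *)
Definition affine (E : normedModType K) (a : K) (f g : dual_space E) : dual_space E :=
  sval (cid (affine_subproof a f g)).

Lemma affineE (E : normedModType K) (a : K) (f g : dual_space E) x :
  affine a f g x = a * (g x - f x) :> K.
Proof. by rewrite /affine; case: cid. Qed.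

Lemma affine_continuous (E : normedModType K) (a : K) (f : dual_space E) :
  continuous (affine a f : weak_star E -> weak_star E).
Proof.
move=> g; have FW : Filter (nbhs (g : weak_star E)) by exact: nbhs_filter.
have FF : Filter (affine a f @ (g : weak_star E)) by exact: fmap_filter.
apply: weak_star_cvg => x.
suff : (fun h : weak_star E => affine a f h x : K^o) @ (g : weak_star E) -->
  (affine a f g x : K^o) by [].
rewrite affineE (_ : (fun h => _) =
    (fun h : weak_star E => a *: (((h : dual_space E) x : K^o) - f x))); last first.
  by apply/funext => h; rewrite affineE.
by apply: cvgZr; apply: cvgB; [exact: eval_continuous | exact: cvg_cst].
Qed.

(** If [f] survives [eta] further derivations at [d e] but has a neighbourhood [V] in which the
    [a]-th derived set at [d] has diameter at most [d], localize to [V] and rescale by [1/d] around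
    [f]: this gives a point surviving [eta] derivations of the unit ball at [e]. *)
Lemma szlenk_submult (E : normedModType K) (d e : R) (eta a : Ord) :
  0 < d -> 0 < e -> ~ (szlenk_iter e (@dual_ball R k E) eta !=set0) ->
  szlenk_iter (d * e) (@dual_ball R k E) (omul eta a) `<=`
  szlenk_iter d (@dual_ball R k E) a.
Proof.
move=> d0 e0 h; elim: a => // [a IH|I i0 g IH] f /=; last first.
  by move=> hf i; exact: IH.
move=> fa; split=> [|V oV Vf].
  by apply: IH; apply: szlenk_iter_anti fa; exact: ole_addr.
rewrite ltNge; apply/negP => dV; apply: h.
have dK : of_real d != 0 :> K by rewrite -of_real0 (inj_eq of_real_inj) gt_eqF.
(* The surviving point is the image of [f], the zero functional. *)
exists (affine (of_real d)^-1 f f).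
rewrite szlenk_iterD in fa.
have {fa}fa := szlenk_iter_local oV (conj fa Vf).
have fs : szlenk_iter d (@dual_ball R k E) a f.
  by have [/IH] := szlenk_iter_sub fa.
have mdV : modulus ((of_real d)^-1 : K) = d^-1.
  by rewrite modulusV modulus_of_real// ltW.
apply: szlenk_iter_map fa; first exact: affine_continuous.
- move=> g [ga Vg]; apply/ereal_supP => _ [x x1 <-].
  rewrite lee_fin affineE modulusM mdV ler_pdivrMl// mulr1 leNgt; apply/negP => dx.
  suff : (d%:E < d%:E)%E by rewrite ltxx.
  apply: lt_le_trans dV; apply/diamP; exists g, f; split=> //.
    by split=> //; exact: IH.
  by apply/dual_distP; exists x.
- move=> g1 g2 _ _ /dual_distP[x x1 ex]; apply/dual_distP; exists x => //.
  by rewrite !affineE -mulrBr opprB addrA subrK modulusM mdV ltr_pdivlMl.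
Qed.

Lemma szlenk_pow (E : normedModType K) (d : R) (eta : Ord) (n : nat) : 0 < d ->
  ~ (szlenk_iter d (@dual_ball R k E) eta !=set0) ->
  ~ (szlenk_iter (d ^+ n.+1) (@dual_ball R k E) (opow eta n.+1) !=set0).
Proof.
move=> d0 h; elim: n => [|n IH]; first by rewrite expr1 /opow /= add0o.
move=> [f ff]; apply: IH; exists f.
rewrite exprSr in ff; apply: szlenk_submult ff => //; exact: exprn_gt0.
Qed.

Lemma nbhs_eval (E : normedModType K) (f : dual_space E) (x : E) (e : R) : 0 < e ->
  nbhs (f : weak_star E) [set g : weak_star E | modulus ((f x : K) - (g : dual_space E) x) < e].
Proof.
move=> e0; have eK : 0 < of_real e :> K by rewrite -of_real0 ltr_of_real.
have FW : Filter (nbhs (f : weak_star E)) by exact: nbhs_filter.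
have /cvgrPdist_lt/(_ _ eK) := @eval_continuous R k E x f.
apply: filterS => g /=; rewrite -[in X in _ -> X](@ltr_of_real R k) -norm_modulus; exact.
Qed.

Lemma closed_dual_ball (E : normedModType K) :
  closed (@dual_ball R k E : set (weak_star E)).
Proof.
move=> f clf; apply/dual_ballP => x; apply/ler_addgt0Pr => e e0.
have [g [/dual_ballP Bg fg]] := clf _ (nbhs_eval f x e0).
rewrite -(subrK (g x : K) (f x)) addrC; apply: (le_trans (ler_modulusD _ _)).
by apply: lerD (Bg x) _; exact: ltW.
Qed.

(** If no derived set below the limit ordinal [lam] were empty, these decreasing weak-star closed
    sets would have a common point by compactness, so the [lam]-th one would be nonempty as well. *)
Lemma szlenk_empty_below (E : completeNormedModType K) (lam : Ord) (e : R) :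
  olimit lam -> index_le (Sz_space E) lam -> 0 < e ->
  exists2 a, olt a lam & ~ (szlenk_iter e (@dual_ball R k E) a !=set0).
Proof.
move=> limlam Elam e0; apply: contrapT => h.
have ne a : olt a lam -> szlenk_iter e (@dual_ball R k E) a !=set0.
  by move=> alam; apply: contrapT => h'; apply: h; exists a.
pose F : set_system (weak_star E) := filter_from [set a | olt a lam]
  (fun a => szlenk_iter e (@dual_ball R k E) a).
have FF : ProperFilter F.
  apply: filter_from_proper; last by move=> a; exact: ne.
  apply: filter_from_filter; first by exists OZero; case: limlam.
  move=> a b alam blam; have [c [clam ac bc]] := @omax_ex (olt^~ lam) _ _ alam blam.
  by exists c => // f fc; split; apply: szlenk_iter_anti fc.
have FB : F (@dual_ball R k E) by exists OZero => //; case: limlam.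
have [f [Bf fF]] := weak_star_compact_ball FF FB.
apply: (@olt_irrefl lam); apply: Elam; exists e => //; exists f.
rewrite szlenk_iter_limit// => a alam.
have cl : closed (szlenk_iter e (@dual_ball R k E) a : set (weak_star E)).
  by apply: closed_szlenk_iter; exact: closed_dual_ball.
by apply: cl => U Uf; apply: fF => //; exists a.
Qed.

End Submultiplicative.

(** * The diagonal operator on a forest *)

(** Letters of nodes are compared by [=], not by [oeq]: different representatives of one ordinal
    give different nodes. *)
HB.instance Definition _ := gen_eqMixin Ord.

Section Suffixes.
Variable T : eqType.
Implicit Types s t u : seq T.

(** Since nodes are written towards the root, the suffixes are the ancestors, the node itself
    included. The empty sequence also occurs; it belongs to no tree. *)
Fixpoint suffixes t : seq (seq T) :=
  t :: (if t is _ :: t' then suffixes t' else [::]).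

Lemma suffixes_refl t : t \in suffixes t.
Proof. by case: t => [|x t]; rewrite inE eqxx. Qed.

Lemma suffixes_cons x t s : (s \in suffixes (x :: t)) = (s == x :: t) || (s \in suffixes t).
Proof. by rewrite inE. Qed.

Definition comparable_seq s t := (s \in suffixes t) || (t \in suffixes s).

Lemma suffixes_comparable s s' t :
  s \in suffixes t -> s' \in suffixes t -> comparable_seq s s'.
Proof.
rewrite /comparable_seq; elim: t => [|x t IH].
  by rewrite !inE => /eqP -> /eqP ->.
rewrite !suffixes_cons => /orP[/eqP ->|st] /orP[/eqP ->|s't].
- by rewrite suffixes_refl.
- by rewrite [X in _ || X]suffixes_cons s't !orbT.
- by rewrite [X in X || _]suffixes_cons st !orbT.
- exact: IH.
Qed.

Lemma suffixes_size s t : s \in suffixes t -> (size s <= size t)%N.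
Proof.
elim: t => [|x t IH]; first by rewrite inE => /eqP ->.
by rewrite suffixes_cons => /orP[/eqP ->//|/IH /leqW].
Qed.

Lemma suffixes_uniq t : uniq (suffixes t).
Proof.
elim: t => [|x t IH] //=; rewrite IH andbT.
by apply/negP => /suffixes_size /=; rewrite ltnn.
Qed.

Lemma comparable_seqC s t : comparable_seq s t = comparable_seq t s.
Proof. exact: orbC. Qed.

End Suffixes.

(** A node is a path written from its end to the root of its tree: the ordinal in
    a letter is the rank of the node, the number tells apart siblings of the same
    rank, and the last letter [(theta i, i)] identifies the tree. *)
Definition node : eqType := seq (Ord * nat).

Definition all_family : family node :=
  @Family node uniq isT (fun=> isT) (fun s h => h).

Definition chain_set (s : seq node) : Prop :=
  uniq s /\ {in s &, forall a b, comparable_seq a b}.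

Program Definition chain_family : family node := @Family node chain_set _ _ _.
Next Obligation. by []. Qed.
Next Obligation.
move=> t; split=> // a b; rewrite !inE => /eqP -> /eqP ->.
by rewrite /comparable_seq suffixes_refl.
Qed.
Next Obligation. by move=> s []. Qed.

Section Diagonal.
Context {R : realType} {k : scalar_kind}.
Local Notation K := (scalars R k).
Local Notation E := (@comb_space R k node all_family).
Local Notation F := (@comb_space R k node chain_family).
Variable c : node -> R.
Hypothesis c01 : forall t, 0 <= c t <= 1.

Let c0 t : 0 <= c t. Proof. by case/andP: (c01 t). Qed.
Let c1 t : c t <= 1. Proof. by case/andP: (c01 t). Qed.

Lemma tail_sum_diag l s (y : node -> K) :
  tail_sum l s (fun t => of_real (c t) * y t) <= tail_sum l s y.
Proof.
apply: ler_sum => t _; rewrite modulusM modulus_of_real//.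
by rewrite ler_piMl ?modulus_ge0.
Qed.

Lemma diag_subproof (y : E) :
  (fun t => of_real (c t) * y t : K) \in comb_pred chain_family.
Proof.
have /asboolP[[d yd] yl] := comb_valP y; apply/asboolP; split.
  by exists d => s [us _]; apply: le_trans (yd s us); exact: tail_sum_diag.
move=> e /yl[l yl']; exists l => s [us _]; apply: le_trans (yl' s us).
exact: tail_sum_diag.
Qed.

Definition diag_fun (y : E) : F := Comb (diag_subproof y).

Lemma diag_linear : linear diag_fun.
Proof.
move=> a y z; apply/val_inj/funext => t /=.
rewrite -[LHS]/(of_real (c t) * (a * y t + z t)).
by rewrite -[RHS]/(a * (of_real (c t) * y t) + of_real (c t) * z t) mulrDr mulrCA.
Qed.

HB.instance Definition _ := GRing.isLinear.Build K E F *:%R diag_fun diag_linear.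

Lemma diag_bounded : bounded_near (diag_fun : {linear E -> F}) (nbhs 0).
Proof.
apply: (@nearly_modulusP R k E F _ 1) => // y.
rewrite of_real1 mul1r !normE ler_of_real; apply: comb_norm_le => s [us _].
apply: (@le_trans _ _ (tail_sum [::] s y)); first exact: tail_sum_diag.
exact: (tail_sum_le_norm y us).
Qed.

Definition diag : operator E F := Operator diag_bounded.

Lemma diagE y t : diag y t = of_real (c t) * y t. Proof. by []. Qed.

Local Notation e_ := (@unit_vec R k node all_family).

Lemma chain_antichain (s A : seq node) : chain_set s -> uniq A ->
  {in A &, forall a b, comparable_seq a b -> a = b} ->
  (size [seq t <- s | t \in A] <= 1)%N.
Proof.
move=> [us sc] uA Aanti; case E : [seq t <- s | t \in A] => [|x [|y r]] //.
have uf : uniq [seq t <- s | t \in A] by rewrite filter_uniq.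
have xm : x \in [seq t <- s | t \in A] by rewrite E !inE eqxx.
have ym : y \in [seq t <- s | t \in A] by rewrite E !inE eqxx orbT.
move: xm ym; rewrite !mem_filter => /andP[xA xs] /andP[yA ys].
have xy := Aanti _ _ xA yA (sc _ _ xs ys).
by move: uf; rewrite E xy /= inE eqxx.
Qed.

(** Test [phi] on the sum of the [u t *: diag (e_ t)] over the antichain, with phases [u t] making
    all terms nonnegative. A chain meets the antichain at most once and [c <= 1], so this vector has
    norm at most one. *)
Lemma antichain_sum (f : dual_space E) (A : seq node) :
  (adjoint diag @` @dual_ball R k F) f -> uniq A ->
  {in A &, forall a b, comparable_seq a b -> a = b} ->
  \sum_(t <- A) modulus (f (e_ t) : K) <= 1.
Proof.
move=> [phi /dual_ballP Bphi <-] uA Aanti.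
have /choice[u uP] t : exists u : K, modulus u = 1 /\
    u * phi (diag (e_ t)) = of_real (modulus (phi (diag (e_ t)) : K)).
  by have [u u1 uE] := modulus_phase (phi (diag (e_ t)) : K); exists u.
pose y : F := \sum_(t <- A) u t *: diag (e_ t).
have phiy : phi y = of_real (\sum_(t <- A) modulus (phi (diag (e_ t)) : K)) :> K.
  rewrite /y linear_sum; elim: A {uA Aanti y} => [|t A IH].
    by rewrite !big_nil of_real0.
  rewrite !big_cons of_realD -IH -(uP t).2; congr (_ + _).
  exact: linearZ.
have ynorm : comb_norm y <= 1.
  apply: comb_norm_le => s Ss; have [us sc] := Ss.
  have yE v : y v = if v \in A then u v * of_real (c v) else 0.
    rewrite comb_sumE; elim: A uA {Aanti y phiy} => [|t A IH]; first by rewrite big_nil.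
    rewrite cons_uniq big_cons inE => /andP[tA /IH->].
    rewrite comb_scaleE diagE unit_vecE.
    have [->|vt] := eqVneq v t; first by rewrite (negPf tA) addr0 mulr1.
    by rewrite !mulr0 add0r.
  rewrite tail_sum_nil; apply: (@le_trans _ _ (\sum_(v <- s | v \in A) 1)).
    rewrite [leRHS]big_mkcond; apply: ler_sum => v _; rewrite yE.
    by case: ifP; rewrite ?modulus0// modulusM (uP v).1 mul1r modulus_of_real.
  rewrite big_const_seq iter_addr_0 -size_filter lern1.
  exact: chain_antichain.
have h := Bphi y; rewrite phiy modulus_of_real in h; last first.
  by apply: sumr_ge0 => t _; exact: modulus_ge0.
apply: (le_trans h); apply: le_trans ynorm.
by rewrite /real_norm normE modulus_of_real// comb_norm_ge0.
Qed.

Lemma coord_le (f : dual_space E) t :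
  (adjoint diag @` @dual_ball R k F) f -> modulus (f (e_ t) : K) <= c t.
Proof.
move=> [phi /dual_ballP Bphi <-]; apply: (le_trans (Bphi (diag (e_ t)))).
rewrite /real_norm normE modulus_of_real ?comb_norm_ge0//.
apply: comb_norm_le => s [us _].
rewrite tail_sum_nil (_ : \sum_(u <- s) _ = \sum_(u <- s | u == t) c t); last first.
  rewrite [RHS]big_mkcond; apply: eq_bigr => u _; rewrite diagE unit_vecE.
  have [->|_] := eqVneq u t; first by rewrite mulr1 modulus_of_real.
  by rewrite mulr0 modulus0.
rewrite big_const_seq iter_addr_0 count_uniq_mem//.
by case: (t \in s); rewrite ?mulr1n// mulr0n.
Qed.

(** The dual norm of [l_1] is the supremum of the coordinates: on a finitely supported part of [x]
    the difference is at most [e], and the rest of [x] is small in norm. *)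
Lemma dual_dist_coord (f g : dual_space E) (e : R) :
  (e%:E < dual_dist f g)%E -> exists t, e < modulus (f (e_ t) - g (e_ t) : K).
Proof.
move=> /dual_distP[x x1 ex]; apply: contrapT => h.
have {}h t : modulus (f (e_ t) - g (e_ t) : K) <= e.
  by rewrite leNgt; apply/negP => ht; apply: h; exists t.
have e0 : 0 <= e by apply: le_trans (h [::]); exact: modulus_ge0.
suff : modulus (f x - g x : K) <= e by rewrite leNgt ex.
have [a a0 fa] := functional_bound f; have [b b0 gb] := functional_bound g.
have nx : comb_norm x <= 1.
  by move: x1; rewrite real_norm_le1 /real_norm normE modulus_of_real// comb_norm_ge0.
apply/ler_addgt0Pr => d d0.
(* The bounds [a] and [b] of [f] and [g] fix how closely [x] must be approximated; the [+ 1] makes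
   the divisor positive. *)
have ab : 0 < a + b + 1 by rewrite ltr_wpDl// addr_ge0.
have [l lx] := restr_approx x (divr_gt0 d0 ab).
set z := restr l x in lx.
have fgB : f x - g x = (f z - g z) + (f (x - z) - g (x - z)) :> K.
  have fB : f (x - z) = f x - f z :> K by exact: linearB.
  have gB : g (x - z) = g x - g z :> K by exact: linearB.
  have sub4 (p q r s : K) : p - q = (r - s) + (p - r - (q - s)) by ring.
  by rewrite fB gB; exact: sub4.
rewrite fgB; apply: (le_trans (ler_modulusD _ _)); apply: lerD.
  have zE : f z - g z = \sum_(t <- undup l) x t * (f (e_ t) - g (e_ t)) :> K.
    have fz : f z = \sum_(t <- undup l) x t * f (e_ t) :> K.
      rewrite /z /restr linear_sum; apply: eq_bigr => t _; exact: linearZ.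
    have gz : g z = \sum_(t <- undup l) x t * g (e_ t) :> K.
      rewrite /z /restr linear_sum; apply: eq_bigr => t _; exact: linearZ.
    by rewrite fz gz -sumrB; apply: eq_bigr => t _; rewrite mulrBr.
  rewrite zE; apply: (le_trans (ler_modulus_sum _ _ _)).
  apply: (@le_trans _ _ (\sum_(t <- undup l) modulus (x t) * e)).
    by apply: ler_sum => t _; rewrite modulusM ler_wpM2l ?modulus_ge0.
  rewrite -mulr_suml ler_piMl//; apply: le_trans nx.
  exact: (@tail_sum_le_norm R k node all_family x (undup l) (undup_uniq l)).
apply: (le_trans (ler_modulusD _ _)); rewrite modulusN.
apply: (@le_trans _ _ ((a + b) * real_norm (x - z))); first by rewrite mulrDl lerD.
rewrite /real_norm normE modulus_of_real ?comb_norm_ge0//.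
apply: (@le_trans _ _ ((a + b) * (d / (a + b + 1)))); first by rewrite ler_wpM2l ?addr_ge0.
by rewrite mulrCA ler_piMr ?(ltW d0)// ler_pdivrMr// mul1r lerDl.
Qed.

End Diagonal.

(** * Upper bound for the Szlenk index of the diagonal operator *)

Section UpperBound.
Context {R : realType} {k : scalar_kind}.
Local Notation K := (scalars R k).
Local Notation E := (@comb_space R k node all_family).
Local Notation F := (@comb_space R k node chain_family).
Local Notation e_ := (@unit_vec R k node all_family).
Variables (c : node -> R) (r : node -> Ord) (b : Ord).
Local Notation lam := (oomega_pow (oomega_pow b)).
Hypothesis c01 : forall t, 0 <= c t <= 1.
Hypothesis r_lt : forall s t, 0 < c s -> 0 < c t -> s \in suffixes t -> s <> t ->
  olt (r t) (r s).
Hypothesis r_bound : forall d : R, 0 < d ->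
  exists2 z, olt z lam & forall t, d < c t -> olt (r t) z.

Local Notation T := (@diag R k c c01 : operator E F).
Local Notation D := (adjoint T @` @dual_ball R k F).

(** [None] marks the slots that hold no node yet; they are given the rank [z]
    above those of all nodes in play. *)
Definition admissible (d : R) (f : dual_space E) (sg : seq (option node)) :=
  (forall i t, nth None sg i = Some t -> d < modulus (f (e_ t) : K)) /\
  (forall i j s t, nth None sg i = Some s -> nth None sg j = Some t -> i <> j ->
     ~~ comparable_seq s t).

Definition orank (z : Ord) (o : option node) := if o is Some t then r t else z.

(** If [t] extends a node of [sg] it replaces that node; otherwise it goes to a free
    slot, which exists since antichain sums are at most [1]. *)
Lemma admissible_extend (d : R) (f g : dual_space E) sg t (z : Ord) :
  0 < d -> 1 < (size sg)%:R * d -> D g -> admissible d f sg ->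
  (forall u, d < c u -> olt (r u) z) ->
  (forall i s, nth None sg i = Some s -> d < modulus (g (e_ s) : K)) ->
  d < modulus (g (e_ t) : K) ->
  (forall i s, nth None sg i = Some s -> t \notin suffixes s) ->
  exists i, [/\ (i < size sg)%N, admissible d g (set_nth None sg i (Some t)) &
    olt (r t) (orank z (nth None sg i))].
Proof.
move=> d0 sgd Dg [_ incomp] rz gs gt tn.
have cpos s : d < modulus (g (e_ s) : K) -> d < c s.
  by move=> /lt_le_trans; apply; exact: coord_le Dg.
(* Both ways of placing [t] reduce to its incomparability with the nodes in the other slots. *)
have ext i : (i < size sg)%N ->
    (forall j s, nth None sg j = Some s -> i <> j -> ~~ comparable_seq s t) ->
    admissible d g (set_nth None sg i (Some t)).
  move=> isg it; split=> [j s|j j' s s'].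
    rewrite nth_set_nth /=; case: eqP => [_ [<-]//|_]; exact: gs.
  rewrite !nth_set_nth /=; case: eqP => [->|ji]; case: eqP => [->|j'i] //.
  - by move=> [<-] s'E _; rewrite comparable_seqC; apply: it s'E _ => /esym.
  - by move=> sE [<-] _; apply: it sE _ => /esym.
  - exact: incomp.
have [[i [a [ia at_]]]|nanc] :=
    pselect (exists i a, nth None sg i = Some a /\ a \in suffixes t).
  have isg : (i < size sg)%N.
    by rewrite ltnNge; apply/negP => ?; rewrite nth_default in ia.
  exists i; split=> //.
    apply: ext => // j s js ij; apply/negP => /orP[st|ts]; last first.
      by move: ts; rewrite (negPf (tn _ _ js)).
    have := incomp _ _ _ _ ia js ij.
    by rewrite (suffixes_comparable at_ st).
  rewrite ia /=; apply: r_lt => //.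
  - exact: lt_trans d0 (cpos _ (gs _ _ ia)).
  - exact: lt_trans d0 (cpos _ gt).
  - by move=> atE; have := tn _ _ ia; rewrite atE suffixes_refl.
have [[i isg iN]|full] := pselect (exists2 i, (i < size sg)%N & nth None sg i = None).
  exists i; split=> //; last by rewrite iN; exact/rz/cpos.
  apply: ext => // j s js _; apply/negP => /orP[st|ts].
    by apply: nanc; exists j, s.
  by move: ts; rewrite (negPf (tn _ _ js)).
(* Now all slots hold nodes, and these form an antichain over which the moduli of [g] would add up
   to more than [1]. *)
exfalso; pose A := map (odflt [::]) sg.
have someP i : (i < size sg)%N -> nth None sg i = Some (nth [::] A i).
  move=> isg; rewrite (nth_map None)//; case E : (nth None sg i) => [//|].
  by case: full; exists i.
have Ainj i j : (i < size A)%N -> (j < size A)%N ->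
    comparable_seq (nth [::] A i) (nth [::] A j) -> i = j.
  rewrite size_map => isg jsg ij; apply: contrapT => nij.
  by have := incomp _ _ _ _ (someP _ isg) (someP _ jsg) nij; rewrite ij.
have uA : uniq A.
  apply/(uniqP [::]) => i j isg jsg ij; apply: Ainj => //.
  by rewrite ij /comparable_seq suffixes_refl.
have : \sum_(s <- A) modulus (g (e_ s) : K) <= 1.
  apply: antichain_sum Dg uA _ => _ _ /(nthP [::])[i iA <-] /(nthP [::])[j jA <-] ij.
  by rewrite (Ainj i j).
rewrite leNgt (lt_le_trans sgd)// -(size_map (odflt [::]) sg) -/A.
apply: (@le_trans _ _ (\sum_(s <- A) d)).
  by rewrite big_const_seq iter_addr_0 count_predT mulr_natl.
rewrite big_seq [leRHS]big_seq; apply: ler_sum => _ /(nthP [::])[i iA <-].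
by apply/ltW/(gs i)/someP; rewrite -(size_map (odflt [::])).
Qed.

(** By induction on the code [a] of the tuple. If a functional of the [a]-th derived set close to
    [f] had a new coordinate above [e / 2], a tuple with a smaller code would be admissible for it,
    against the induction hypothesis. Hence near [f] the [a]-th derived set has diameter at most
    [e]. The base is [OSucc z] because empty slots have rank [z]. *)
Lemma admissible_not_szlenk (e : R) (z : Ord) : 0 < e ->
  (forall t, e / 2 < c t -> olt (r t) z) ->
  forall (sg : seq (option node)) (f : dual_space E),
  1 < (size sg)%:R * (e / 2) -> admissible (e / 2) f sg ->
  ~ szlenk_iter e D (OSucc (olex (OSucc z) (map (orank z) sg))) f.
Proof.
move=> e0 rz sg.
have [a] : exists a, a = olex (OSucc z) (map (orank z) sg).
  by exists (olex (OSucc z) (map (orank z) sg)).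
elim/(well_founded_induction olt_wf): a sg => a IH sg aE f sgd fsg.
have d0 : 0 < e / 2 by rewrite divr_gt0.
rewrite -aE => -[fa df].
have Df : D f by exact: szlenk_iter_sub fa.
(* A perturbation by less than the gap keeps the coordinate above [e / 2]; an empty slot gets an
   arbitrary positive value. *)
pose gap (o : option node) := if o is Some t then modulus (f (e_ t) : K) - e / 2 else 1.
have [tau tau0 [taue taug]] : exists2 tau, 0 < tau & tau <= e / 2 /\
    forall o, o \in sg -> tau <= gap o.
  have {fsg} : forall o, o \in sg -> 0 < gap o.
    case=> [t|]; last by rewrite /gap.
    by move=> /(nthP None)[i _ it]; rewrite /gap subr_gt0; exact: fsg.1 it.
  elim: sg {IH aE sgd fa df} => [|o s IHs] h; first by exists (e / 2).
  have [|tau tau0 [te ts]] := IHs.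
    by move=> o' o's; apply: h; rewrite inE o's orbT.
  exists (Num.min tau (gap o)).
    by rewrite lt_min tau0 h// inE eqxx.
  split; first by rewrite ge_min te.
  move=> o'; rewrite inE => /orP[/eqP ->|/ts o't]; first by rewrite ge_min lexx orbT.
  by rewrite ge_min o't.
(* The finitely many ancestors of the nodes in play; near [f] their coordinates are controlled by
   [tau], all others by [NV]. *)
pose L := flatten (map (fun o : option node => if o is Some t then suffixes t else [::]) sg).
have LP o t s : o \in sg -> o = Some t -> s \in suffixes t -> s \in L.
  move=> osg oE st; apply/flattenP; exists (suffixes t) => //.
  by apply/mapP; exists o => //; rewrite oE.
pose N : set (weak_star E) := [set g : weak_star E |
  forall t, t \in L -> modulus ((f (e_ t) : K) - (g : dual_space E) (e_ t)) < tau].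
have Nf : nbhs (f : weak_star E) N.
  have FW : Filter (nbhs (f : weak_star E)) by exact: nbhs_filter.
  apply: (@filter_all_seq _ _ FW _ L (fun t => [set g : weak_star E |
    modulus ((f (e_ t) : K) - (g : dual_space E) (e_ t)) < tau])) => t.
  exact: nbhs_eval.
(* A node outside [L] is an ancestor of no node in [sg], as [admissible_extend] requires. *)
have NV : forall g, szlenk_iter e D a g -> N g ->
    forall t, t \notin L -> modulus (g (e_ t) : K) <= e / 2.
  move=> g ga Ng t tL; rewrite leNgt; apply/negP => gt.
  have nsg i s : nth None sg i = Some s -> nth None sg i \in sg.
    move=> is_; apply: mem_nth; rewrite ltnNge; apply/negP => ?.
    by rewrite nth_default in is_.
  have gs i s : nth None sg i = Some s -> e / 2 < modulus (g (e_ s) : K).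
    move=> is_; have sgs := nsg _ _ is_.
    have := taug _ sgs; rewrite is_ /gap => taus.
    have := Ng s (LP _ _ _ sgs is_ (suffixes_refl s)) => fg.
    have fs : modulus (f (e_ s) : K) <=
        modulus ((f (e_ s) : K) - g (e_ s)) + modulus (g (e_ s) : K).
      by apply: le_trans (ler_modulusD _ _); rewrite subrK.
    by lra.
  have [|i [isg gsg rt]] := admissible_extend d0 sgd (szlenk_iter_sub ga) fsg rz gs gt.
    by move=> i s is_; apply: contra tL; exact: LP (nsg _ _ is_) is_.
  have asg : map (orank z) (set_nth None sg i (Some t)) = set_nth OZero (map (orank z) sg) i (r t).
    elim: (sg) i isg {gsg rt} => // o s IHs [|i] //= isg; congr (_ :: _); exact: IHs.
  have lt_a : olt (olex (OSucc z) (map (orank z) (set_nth None sg i (Some t)))) a.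
    rewrite aE asg; apply: olex_set_nth; rewrite ?size_map//; last first.
      by rewrite (nth_map None).
    move=> j jsg; rewrite (nth_map None)//; case E : (nth None sg j) => [s|] /=.
      apply: olt_trans (olt_succ z); apply: rz; apply: lt_le_trans (fsg.1 _ _ E) _.
      exact: coord_le Df.
    exact: olt_succ.
  apply: (IH _ lt_a _ erefl g _ gsg).
    by rewrite size_set_nth (maxn_idPr isg).
  exact: szlenk_iter_anti ga.
have oN : open (interior N) by exact: open_interior.
have /diamP[g [h [[ga /interior_subset Ng] [ha /interior_subset Nh] gh]]] := df _ oN Nf.
have [t] := dual_dist_coord gh; apply/negP; rewrite -leNgt.
(* On [L] both coordinates are within [tau <= e / 2] of that of [f]; outside [L] both have modulus
   at most [e / 2]. *)
have [tL|tL] := boolP (t \in L).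
  have -> : g (e_ t) - h (e_ t) =
      - ((f (e_ t) : K) - g (e_ t)) + (f (e_ t) - h (e_ t)) :> K by ring.
  apply: (le_trans (ler_modulusD _ _)); rewrite modulusN.
  by have := Ng _ tL; have := Nh _ tL; lra.
apply: (le_trans (ler_modulusD _ _)); rewrite modulusN.
by have := NV g ga Ng t tL; have := NV h ha Nh t tL; lra.
Qed.

(** The tuple of empty slots is admissible for every functional, so its code bounds the [e]-index;
    the code is below [lam] because [lam] is closed under sums and products. *)
Theorem szlenk_diag_le : index_le (Sz_operator T) lam.
Proof.
move=> a [e e0 [f fa]].
have d0 : 0 < e / 2 by rewrite divr_gt0.
have [z zl rz] := r_bound d0.
(* This gives [M e / 2 > 1], so an antichain of large coordinates cannot fill [M] slots. *)
pose M := Num.bound (e / 2)^-1.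
pose sg := nseq M (None : option node).
have sgd : 1 < (size sg)%:R * (e / 2).
  rewrite size_nseq -ltr_pdivrMr// div1r; apply: archi_boundP.
  by rewrite invr_ge0 ltW.
have olex_lam : olt (OSucc (olex (OSucc z) (map (orank z) sg))) lam.
  apply: tower_succ; apply: tower_lex; first exact: tower_succ.
  move=> j; rewrite size_map => jM; rewrite (nth_map None)// nth_nseq.
  by case: ifP => _; exact: olt_succ.
have [la|al] := ole_total (OSucc (olex (OSucc z) (map (orank z) sg))) a.
  exfalso; apply: (admissible_not_szlenk e0 rz sgd (f := f)).
    by split=> [i t|i j s t]; rewrite nth_nseq; case: ifP.
  exact: szlenk_iter_anti fa.
exact: olt_trans al olex_lam.
Qed.

End UpperBound.

(** Diagonalization: [z i] dominates [e n i] for all [n <= i], hence any given [a] once [i] is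
    large. The shift [j] leaves room for the constant lost in a factorization. *)
Lemma cofinal_power_seq b : countable_cofinality b ->
  exists theta : nat -> Ord,
    (forall i, olt (theta i) (oomega_pow (oomega_pow b))) /\
    forall a j, olt a (oomega_pow (oomega_pow b)) ->
      exists i, ole (opow a (i + j).+1) (theta i).
Proof.
move=> /cofinal_tower[e [elam emono ecof]].
have /choice[z zP] i : exists z, olt z (oomega_pow (oomega_pow b)) /\
    forall n, n \in iota 0 i.+1 -> ole (e n i) z.
  have [z zl h] := @tower_bound b nat (iota 0 i.+1) (fun n => e n i) (fun n => elam n i).
  by exists z.
(* The exponent [2i + 1] exceeds [i + j] as soon as [i >= j]; the successor makes the base at least
   [1], so that powers increase with the exponent. *)
exists (fun i => opow (OSucc (z i)) (i + i).+1); split=> [i|a j alam].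
  by apply: tower_pow; apply: tower_succ; case: (zP i).
have [n [m anm]] := ecof _ alam.
exists (maxn n (maxn m j)); set i := maxn n _.
apply: opow_le => //; last by rewrite ltnS leq_add2l /i !leq_max leqnn !orbT.
apply: ole_trans anm _; apply: ole_trans (emono n m i _) _.
  by rewrite /i !leq_max leqnn orbT.
apply: ole_trans (olt_ole (olt_succ _)); apply: (zP i).2.
by rewrite mem_iota add0n ltnS /i leq_max leqnn.
Qed.

Lemma half_exp_lt (R : realType) (d : R) : 0 < d -> exists n, (2^-1) ^+ n < d.
Proof.
move=> d0; exists (Num.bound d^-1); rewrite exprVn invf_plt ?posrE ?exprn_gt0//.
have d1 : 0 <= d^-1 by rewrite invr_ge0 ltW.
by apply: (lt_trans (archi_boundP d1)); rewrite -natrX ltr_nat ltn_expl.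
Qed.

(** * The forest and its weights *)

Section Tree.
Variable theta : nat -> Ord.

Fixpoint valid (t : node) : Prop :=
  match t with
  | [::] => False
  | p :: t' => match t' with
    | [::] => p.1 = theta p.2
    | q :: _ => olt p.1 q.1 /\ valid t'
    end
  end.

(** The default letter here and in [tree_index] is reached only at the empty sequence, which is not
    [valid]. *)
Definition node_rank (t : node) : Ord := (head (OZero, 0%N) t).1.

Definition tree_index (t : node) : nat := (last (OZero, 0%N) t).2.

Lemma valid_rank_lt s t : valid s -> valid t -> s \in suffixes t -> s <> t ->
  olt (node_rank t) (node_rank s).
Proof.
move=> vs; elim: t => [//|p [|q t'] IH].
  move=> _; rewrite suffixes_cons inE => /orP[/eqP//|/eqP sE]; by rewrite sE in vs.
move=> [pq vt]; rewrite suffixes_cons => /orP[/eqP//|st] _.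
have [->//|sq] := eqVneq s (q :: t').
by apply: olt_trans pq _; apply: IH => //; exact/eqP.
Qed.

Lemma valid_rank_le t : valid t -> ole (node_rank t) (theta (tree_index t)).
Proof.
elim: t => [//|p [|q t'] IH].
  by move=> /= pE; rewrite /node_rank /tree_index /= -pE; exact: ole_refl.
by move=> [pq /IH]; apply: ole_trans; exact: olt_ole.
Qed.

Variable R : realType.

(** The spaces have coordinates at all sequences of letters; the zero coefficient makes the operator
    kill those outside the forest. *)
Definition coef (t : node) : R :=
  if `[< valid t >] then (2^-1) ^+ tree_index t else 0.

Lemma coef01 t : 0 <= coef t <= 1.
Proof.
rewrite /coef; case: ifP => _; last by rewrite lexx ler01.
by rewrite exprn_ge0 ?exprn_ile1//; lra.
Qed.

Lemma coef_valid t : 0 < coef t -> valid t.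
Proof. by rewrite /coef; case: ifP => [/asboolP//|]; rewrite ltxx. Qed.

(** A coefficient above [d] confines the node to the finitely many trees with [2^-i > d], and their
    ranks have a common bound below the limit ordinal. *)
Lemma coef_rank_bound b (d : R) :
  (forall i, olt (theta i) (oomega_pow (oomega_pow b))) -> 0 < d ->
  exists2 z, olt z (oomega_pow (oomega_pow b)) &
    forall t, d < coef t -> olt (node_rank t) z.
Proof.
move=> tl d0; have [N Nd] := half_exp_lt d0.
have [z zl h] := @tower_bound b nat (iota 0 N) theta tl.
exists (OSucc z) => [|t dt]; first exact: tower_succ.
have vt : valid t by apply: coef_valid; exact: lt_trans dt.
apply: (ole_trans (valid_rank_le vt)); apply: h.
rewrite mem_iota add0n ltnNge; apply/negP => Nt.
have : (2^-1 : R) ^+ tree_index t <= 2^-1 ^+ N by rewrite ler_wiXn2l//; lra.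
rewrite leNgt (lt_trans Nd)//; move: dt; rewrite /coef; by case: ifP; rewrite ?asboolT.
Qed.

(** * Lower bound for spaces through which the operator factors *)

Section LowerBound.
Variable k : scalar_kind.
Local Notation K := (scalars R k).
Local Notation E := (@comb_space R k node all_family).
Local Notation F := (@comb_space R k node chain_family).
Local Notation e_ := (@unit_vec R k node all_family).
Local Notation T := (@diag R k coef coef01 : operator E F).

Lemma suffixes_chain t : chain_set (suffixes t).
Proof. by split=> [|s s']; [exact: suffixes_uniq | exact: suffixes_comparable]. Qed.

(** The functionals are pulled back to [G] only along [B], so no compactness is
    needed to move the derivations of [F] to [G]. *)
Lemma szlenk_factor_lower (G : normedModType K) (A : operator E G) (B : operator G F) :
  (forall x, T x = B (A x)) ->
  exists2 C : R, 0 < C & forall i (e : R), e * C < 2^-1 ^+ i ->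
    szlenk_iter e (@dual_ball R k G) (theta i) !=set0.
Proof.
move=> TBA; have [al al0 hA] := operator_bound A; have [be be0 hB] := operator_bound B.
exists (al * be) => [|i e eC]; first exact: mulr_gt0.
have hBr z : comb_norm (B z) <= be * real_norm z.
  by have := hB z; rewrite normE real_normE -of_realM ler_of_real.
have hAr x : real_norm (A x) <= al * comb_norm x.
  by have := hA x; rewrite normE real_normE -of_realM ler_of_real.
(* The functional summing over the ancestors of [t], composed with [B] and divided by the bound of
   [B] to land in the unit ball. *)
have /choice[psi psiE] t : exists psi : dual_space G, forall z,
    psi z = of_real be^-1 * \sum_(s <- suffixes t) B z s :> K.
  have lin : linear ((fun z => of_real be^-1 * \sum_(s <- suffixes t) B z s) : G -> K^o).
    move=> a x y.
    have sumE : \sum_(s <- suffixes t) B (a *: x + y) s =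
        a * (\sum_(s <- suffixes t) B x s) + \sum_(s <- suffixes t) B y s :> K.
      rewrite mulr_sumr -big_split; apply: eq_bigr => s _.
      by have -> : B (a *: x + y) = a *: B x + B y by exact: linearP.
    rewrite sumE -[RHS]/(a * (of_real be^-1 * \sum_(s <- suffixes t) B x s) +
      of_real be^-1 * \sum_(s <- suffixes t) B y s).
    by rewrite mulrDr mulrCA.
  have bnd z : modulus (of_real be^-1 * \sum_(s <- suffixes t) B z s : K) <= 1 * real_norm z.
    rewrite modulusM modulus_of_real ?invr_ge0 ?(ltW be0)// mul1r ler_pdivrMl//.
    apply: le_trans (hBr z); apply: (le_trans (ler_modulus_sum _ _ _)).
    exact: (tail_sum_le_norm (B z) (suffixes_chain t)).
  by exists (mk_functional lin ler01 bnd).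
have psiB t : dual_ball (psi t).
  apply/dual_ballP => z; rewrite psiE modulusM modulus_of_real ?invr_ge0 ?(ltW be0)//.
  rewrite ler_pdivrMl//; apply: le_trans (hBr z); apply: (le_trans (ler_modulus_sum _ _ _)).
  exact: (tail_sum_le_norm (B z) (suffixes_chain t)).
pose child (t : node) a j : node := (a, j) :: t.
have psi_cvg t a : (fun j => psi (child t a j) : weak_star G) @ \oo --> (psi t : weak_star G).
  apply: weak_star_cvg => z.
  suff : (fun j => psi (child t a j) z : K^o) @ \oo --> (psi t z : K^o) by [].
  apply/cvgrPdist_le => d' /pos_of_real[d d0 ->].
  have /asboolP[_ /(_ _ (mulr_gt0 d0 be0))[l lz]] := comb_valP (B z).
  (* Beyond all sibling numbers occurring in [l] the child lies outside [l], so its coordinate is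
     part of a small tail of [B z]. *)
  exists (\max_(s <- l) (head (OZero, 0%N) s).2).+1 => // j /= lj.
  have jl : child t a j \notin l.
    apply/negP => cl; move: lj; rewrite ltnNge => /negP; apply.
    exact: (@leq_bigmax_seq _ l predT (fun s : node => (head (OZero, 0%N) s).2) _ cl isT).
  have -> : psi t z - psi (child t a j) z = - (of_real be^-1 * B z (child t a j)) :> K.
    by rewrite !psiE /child /= big_cons; ring.
  apply: (@le_trans _ _ (of_real (modulus (- (of_real be^-1 * B z (child t a j)) : K)))).
    by rewrite -norm_modulus.
  rewrite ler_of_real modulusN modulusM modulus_of_real ?invr_ge0 ?(ltW be0)//.
  rewrite ler_pdivrMl// mulrC; apply: le_trans (lz [:: child t a j] _); last exact: fam1.
  by rewrite /tail_sum big_cons big_nil jl addr0.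
have valid_child t a j : valid t -> olt a (node_rank t) -> valid (child t a j).
  by case: t => [//|p t'] vt at_; split.
have index_child t a j : valid t -> tree_index (child t a j) = tree_index t.
  by case: t.
(* A node of rank at least [a] gives a point of the [a]-th derived set; for a successor, its
   children of rank exactly [a] converge to it and stay more than [e] away. *)
have key a t : valid t -> tree_index t = i -> ole a (node_rank t) ->
    szlenk_iter e (@dual_ball R k G) a (psi t).
  elim: a t => [|a IH|I i0 f IH] t vt ti; first by move=> _; exact: psiB.
    move=> at_; split=> [|V oV Vt].
      by apply: IH => //; exact: olt_ole.
    have [N _ NV] := psi_cvg t a _ (open_nbhs_nbhs (conj oV Vt)).
    pose u := child t a N.
    have vu : valid u by exact: valid_child.
    have ui : tree_index u = i by rewrite index_child.
    apply/diamP; exists (psi u), (psi t); split.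
    - split; last exact: (NV N (leqnn N)).
      by apply: IH => //; exact: ole_refl.
    - by split=> //; apply: IH => //; exact: olt_ole.
    (* On this vector of the unit ball only the new ancestor [u] contributes, with the value
       [2^-i / (al be) > e]. *)
    apply/dual_distP; exists (of_real al^-1 *: A (e_ u)).
      rewrite normrZ norm_modulus modulus_of_real ?invr_ge0 ?(ltW al0)// real_normE.
      rewrite -of_realM -of_real1 ler_of_real ler_pdivrMl//.
      apply: (le_trans (hAr _)); rewrite ler_wpM2l ?(ltW al0)//.
      exact: unit_vec_norm.
    have -> : psi u (of_real al^-1 *: A (e_ u)) - psi t (of_real al^-1 *: A (e_ u)) =
        of_real be^-1 * (of_real al^-1 * of_real (coef u)) :> K.
      have Bz : B (of_real al^-1 *: A (e_ u)) u = of_real al^-1 * of_real (coef u) :> K.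
        have -> : B (of_real al^-1 *: A (e_ u)) = of_real al^-1 *: B (A (e_ u)).
          exact: linearZ.
        by rewrite -TBA comb_scaleE diagE unit_vecE eqxx mulr1.
      by rewrite !psiE /u /child /= big_cons -/(child t a N) -/u -Bz; ring.
    have cu : coef u = 2^-1 ^+ i by rewrite /coef asboolT// ui.
    rewrite !modulusM !modulus_of_real ?invr_ge0 ?(ltW al0) ?(ltW be0)//; last first.
      by case/andP: (coef01 u).
    by rewrite cu mulrA -invfM mulrC ltr_pdivlMr ?mulr_gt0// [be * al]mulrC.
  by move=> fa j; apply: IH.
(* The root of the [i]-th tree has rank [theta i]. *)
exists (psi [:: (theta i, i)]); apply: key => //; exact: ole_refl.
Qed.

End LowerBound.
End Tree.

(** * Failure of factorization *)

Lemma Sz_operator_id (R : realType) (k : scalar_kind)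
    (G : completeNormedModType (scalars R k)) (a : Ord) :
  index_le (Sz_operator (op_id G)) a -> index_le (Sz_space G) a.
Proof.
move=> Ga x [e e0 [f fx]]; apply: Ga; exists e => //; exists (adjoint (op_id G) f).
(* The functional [adjoint (op_id G) f] has the values of [f] but is built as a composite, so the
   derivations are transported rather than identified. *)
apply: szlenk_iter_map fx => [g|g Bg|//]; last by exists g.
have FW : Filter (nbhs (g : weak_star G)) by exact: nbhs_filter.
have FF : Filter (adjoint (op_id G) @ (g : weak_star G)) by exact: fmap_filter.
by apply: weak_star_cvg => z; exact: (@eval_continuous R k G z g).
Qed.

Theorem theorem5p1 (R : realType) (k : scalar_kind) (b : Ord)
    (hb : countable_cofinality b) :
  ~ factorization_property (@SZ R k (oomega_pow b)) /\
  exists (E F : completeNormedModType (scalars R k)) (T : operator E F),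
    index_le (Sz_operator T) (oomega_pow (oomega_pow b)) /\
    forall G : completeNormedModType (scalars R k),
      index_le (Sz_space G) (oomega_pow (oomega_pow b)) ->
      ~ factors_through T G.
Proof.
suff [E [F [T [Tb TG]]]] : exists (E F : completeNormedModType (scalars R k))
    (T : operator E F), index_le (Sz_operator T) (oomega_pow (oomega_pow b)) /\
    forall G : completeNormedModType (scalars R k),
      index_le (Sz_space G) (oomega_pow (oomega_pow b)) -> ~ factors_through T G.
  split; last by exists E, F, T.
  by move=> /(_ E F T Tb)[G /Sz_operator_id Gb]; exact: TG.
have [theta [tl tcof]] := cofinal_power_seq hb.
exists (@comb_space R k node all_family), (@comb_space R k node chain_family),
  (diag (coef01 theta R)); split.
  apply: (@szlenk_diag_le R k _ (@node_rank) b) => [s t cs ct st nst|d d0].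
    by apply: (@valid_rank_lt theta) st nst; apply: (@coef_valid theta R).
  exact: coef_rank_bound.
move=> G Gb [A [B TBA]].
have [C C0 low] := szlenk_factor_lower TBA.
have h0 : 0 < 2^-1 :> R by lra.
have [eta etab etaN] := szlenk_empty_below (tower_limit b) Gb h0.
(* This [j] absorbs the constant: [2^-(i+j+1) C < 2^-i] for every [i]. *)
have [j Cj] := half_exp_lt (divr_gt0 h0 C0 : 0 < 2^-1 / C).
have [i ti] := tcof eta j etab.
(* At [2^-(i+j+1)] the derived set of order [eta^(i+j+1)] is empty by submultiplicativity, while the
   [i]-th tree makes the one of order [theta i], which is at least as large, nonempty. *)
apply: (szlenk_pow (n := i + j) h0 etaN).
have [|f ft] := low i ((2^-1) ^+ (i + j).+1); last by exists f; exact: szlenk_iter_anti ft.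
rewrite -addnS exprD -mulrA gtr_pMr ?exprn_gt0//.
rewrite -ltr_pdivlMr// div1r; apply: (@le_lt_trans _ _ (2^-1 ^+ j)).
  by rewrite exprS ler_piMl ?exprn_ge0//; lra.
apply: (lt_trans Cj); rewrite gtr_pMl ?invr_gt0//; lra.
Qed.
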